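(* Let $n\ge 1$, $N=2^n$, and let $(\omega,\gamma)$ be a 4-round key-schedule that is good (in the sense defined in the context) with parameters $\delta_1,\delta_2,\delta_3$. Consider the 4-round cipher $\mathsf{KAFw}^{P,(\omega,\gamma)}$ built on a uniformly random permutation $P$ of $\{0,1\}^n$. Then for all non-negative integers $q_f,q_e$ with $q_f+2q_e\le N/2$, $$\mathbf{Adv}^{\oplus\text{-rka}}_{\mathsf{KAFw}^{P,(\omega,\gamma)}}(q_f,q_e)\le 2\delta_1 q_e q_f+(\delta_2+\delta_3)q_e^2+\frac{8q_eq_f+27q_e^2+4q_e}{N}.$$
   Context: Let $n\ge1$ and $N=2^n$; identify $\{0,1\}^n$ with $\mathbb{F}_2^n$ and write $X\|Y$ for concatenation. A $t$-round key-schedule $(\omega,\gamma)$ consists of maps $\omega=(\omega_0,\omega_1,\omega_2,\omega_3)$ and $\gamma=(\gamma_1,\dots,\gamma_t)$, each from $\{0,1\}^n$ to $\{0,1\}^n$. For $f:\{0,1\}^n\to\{0,1\}^n$ and $\kappa\in\{0,1\}^n$ let $\Psi^f_\kappa(W_L\|W_R)=W_R\|(W_L\oplus f(\kappa\oplus W_R))$. The $t$-round cipher with key $k\in\{0,1\}^n$ is $\mathsf{KAFw}^{f,(\omega,\gamma)}_k(W)=(\omega_2(k)\|\omega_3(k))\oplus\Psi^f_{\gamma_t(k)}\circ\cdots\circ\Psi^f_{\gamma_1(k)}\big((\omega_0(k)\|\omega_1(k))\oplus W\big)$, a blockcipher on $2n$-bit blocks with $n$-bit keys (the same $f$ in every round).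 A 4-round key-schedule is good with parameters $\delta_1,\delta_2,\delta_3$ if, with $\varphi_1(k)=\omega_1(k)\oplus\gamma_1(k)$ and $\varphi_4(k)=\omega_2(k)\oplus\gamma_4(k)$: (i) for $i\in\{1,4\}$, for all $\Delta,y\in\{0,1\}^n$, $\Pr_{k}[\varphi_i(k\oplus\Delta)=y]\le\delta_1$, and for all $\Delta\ne\Delta'$ and all $y$, $\Pr_k[\varphi_i(k\oplus\Delta)\oplus\varphi_i(k\oplus\Delta')=y]\le\delta_2$; (ii) for all $\Delta,\Delta',y$, $\Pr_k[\varphi_1(k\oplus\Delta)\oplus\varphi_4(k\oplus\Delta')=y]\le\delta_3$; here $k$ is uniform in $\{0,1\}^n$. No condition is imposed on $\gamma_2,\gamma_3,\omega_0,\omega_3$ beyond what is stated. Related-key security: for a blockcipher $E$ with $n$-bit keys and $2n$-bit blocks and a key $k$, the oracle $\mathsf{RK}[E_k]$ takes $(\Delta,LR)$ and returns $E_{k\oplus\Delta}(LR)$, and its inverse takes $(\Delta,ST)$ and returns $E^{-1}_{k\oplus\Delta}(ST)$. A distinguisher $D$ (computationally unbounded) gets two-sided access to the related-key oracle and access to the round function $f$ (both directions when $f$ is a permutation). In the real world $k$ is uniform, $f$ is random as specified, and $D$ interacts with $(\mathsf{RK}[\mathsf{KAFw}^{f,(\omega,\gamma)}_k],f)$; in the ideal world $D$ interacts with $(\mathsf{RK}[\mathsf{IC}_k],f)$ where $\mathsf{IC}$ is a uniformly random blockcipher with $2n$-bit blocks and $n$-bit keys, independent of $f$, and $k$ is uniform.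 The advantage of $D$ is the absolute difference of the probabilities that $D$ outputs 1 in the two worlds, and $\mathbf{Adv}^{\oplus\text{-rka}}(q_f,q_e)$ is the maximum advantage over all distinguishers making $q_f$ queries to $f$ and $q_e$ queries in total to the related-key oracle. *)

(* Defs.v *)
From HB Require Import structures.
From mathcomp Require Import all_boot all_order all_algebra all_fingroup.
Set Implicit Arguments. Unset Strict Implicit. Unset Printing Implicit Defensive.
Import Order.TTheory GRing.Theory Num.Theory.
Local Open Scope ring_scope.

(* {0,1}^n identified with F_2^n; XOR is addition. *)
Notation B n := ('rV['F_2]_n) (only parsing).

(* 2n-bit blocks W_L || W_R are represented as pairs (W_L, W_R). *)

Definition Psi (n : nat) (f : B n -> B n) (kap : B n) (W : B n * B n) : B n * B n :=
  (W.2, W.1 + f (kap + W.2)).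

Definition Psi_inv (n : nat) (f : B n -> B n) (kap : B n) (W : B n * B n) : B n * B n :=
  (W.2 + f (kap + W.1), W.1).

(* t-round KAFw; gamma_{i+1} is g i for i : 'I_t. *)
Definition KAFw (n t : nat) (f : B n -> B n) (w0 w1 w2 w3 : B n -> B n)
    (g : 'I_t -> B n -> B n) (k : B n) (W : B n * B n) : B n * B n :=
  let W0 := (w0 k + W.1, w1 k + W.2) in
  let W' := foldl (fun X i => Psi f (g i k) X) W0 (enum 'I_t) in
  (w2 k + W'.1, w3 k + W'.2).

Definition KAFw_inv (n t : nat) (f : B n -> B n) (w0 w1 w2 w3 : B n -> B n)
    (g : 'I_t -> B n -> B n) (k : B n) (C : B n * B n) : B n * B n :=
  let C0 := (w2 k + C.1, w3 k + C.2) in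
  let C' := foldl (fun X i => Psi_inv f (g i k) X) C0 (rev (enum 'I_t)) in
  (w0 k + C'.1, w1 k + C'.2).

Definition prk (R : realFieldType) (n : nat) (P : pred (B n)) : R :=
  #|[set k : B n | P k]|%:R / #|{: B n}|%:R.

Definition good_ks (R : realFieldType) (n : nat) (w1 w2 : B n -> B n)
    (g : 'I_4 -> B n -> B n) (d1 d2 d3 : R) : Prop :=
  let phi1 := fun k => w1 k + g ord0 k in
  let phi4 := fun k => w2 k + g ord_max k in
  (forall phi, phi = phi1 \/ phi = phi4 ->
     (forall D y : B n, prk R (fun k => phi (k + D) == y) <= d1) /\
     (forall D D' y : B n, D != D' ->
        prk R (fun k => phi (k + D) + phi (k + D') == y) <= d2)) /\
  (forall D D' y : B n, prk R (fun k => phi1 (k + D) + phi4 (k + D') == y) <= d3).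

(* Adaptive, computationally unbounded (possibly randomized) distinguishers as
   interaction trees: fair coin flips, forward/inverse round-function queries,
   forward/inverse related-key queries (Delta, LR) / (Delta, ST). *)
Inductive dist (n : nat) : Type :=
| DOut of bool
| DCoin of (bool -> dist n)
| DQf of B n & (B n -> dist n)
| DQfinv of B n & (B n -> dist n)
| DQe of B n & (B n * B n) & (B n * B n -> dist n)
| DQeinv of B n & (B n * B n) & (B n * B n -> dist n).

Fixpoint queries_ok (n : nat) (D : dist n) (qf qe : nat) : Prop :=
  match D with
  | DOut _ => True
  | DCoin c => forall b, queries_ok (c b) qf qe
  | DQf _ c => (0 < qf)%N /\ forall y, queries_ok (c y) qf.-1 qe
  | DQfinv _ c => (0 < qf)%N /\ forall y, queries_ok (c y) qf.-1 qe
  | DQe _ _ c => (0 < qe)%N /\ forall y, queries_ok (c y) qf qe.-1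
  | DQeinv _ _ c => (0 < qe)%N /\ forall y, queries_ok (c y) qf qe.-1
  end.

Fixpoint run (R : realFieldType) (n : nat) (D : dist n)
    (f finv : B n -> B n) (e einv : B n -> B n * B n -> B n * B n) : R :=
  match D with
  | DOut b => (b : nat)%:R
  | DCoin c => (run R (c true) f finv e einv + run R (c false) f finv e einv) / 2
  | DQf x c => run R (c (f x)) f finv e einv
  | DQfinv y c => run R (c (finv y)) f finv e einv
  | DQe d W c => run R (c (e d W)) f finv e einv
  | DQeinv d C c => run R (c (einv d C)) f finv e einv
  end.

Definition P_real (R : realFieldType) (n : nat) (w0 w1 w2 w3 : B n -> B n)
    (g : 'I_4 -> B n -> B n) (D : dist n) : R :=
  (\sum_(k : B n) \sum_(P : {perm B n})
     run R D (fun x => P x) (fun y => (P^-1)%g y)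
       (fun d W => KAFw (fun x => P x) w0 w1 w2 w3 g (k + d) W)
       (fun d C => KAFw_inv (fun x => P x) w0 w1 w2 w3 g (k + d) C))
  / (#|{: B n}| * #|{: {perm B n}}|)%:R.

Definition P_ideal (R : realFieldType) (n : nat) (D : dist n) : R :=
  (\sum_(k : B n) \sum_(P : {perm B n}) \sum_(IC : {ffun B n -> {perm (B n * B n)}})
     run R D (fun x => P x) (fun y => (P^-1)%g y)
       (fun d W => IC (k + d) W)
       (fun d C => ((IC (k + d))^-1)%g C))
  / (#|{: B n}| * #|{: {perm B n}}| * #|{: {ffun B n -> {perm (B n * B n)}}}|)%:R.

(* Main.v *)
(* H-coefficient argument. A transcript consists of the queries to the permutation
   P, those to the related-key oracle, and (revealed at the end) the key k: P_real
   and P_ideal are sums over transcripts of #{compatible worlds}, so it suffices to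
   bound below, on good transcripts, the ratio of the real to the ideal weight.

   Given k, the inputs u1 and u4 of P in the rounds 1 and 4 are determined by the
   transcript, and goodA says that these are fresh and do not collide unduly; it
   fails with probability at most 2 d1 qe qf + (d2 + d3) qe^2 over k. Once P is known on
   these inputs, a related-key query prescribes exactly one value of P in round 2
   and one in round 3. If all prescribed inputs and outputs are fresh and distinct,
   which fails with probability at most (8 qe qf + 24 qe^2) / N, there are 2 qe new
   constraints on P, and (N - a)^_(2 qe) <= (N^2)^_qe makes them at least as likely
   as in the ideal world. Some collisions of the prescribed outputs depend on the
   transcript only; goodB excludes these and fails with probability at
   most (3 qe^2 + 4 qe) / N over the ideal cipher. *)
Require Import Defs.
From HB Require Import structures.
From mathcomp Require Import all_boot all_order all_algebra all_fingroup.
From mathcomp Require Import zify ring lra.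
Set Implicit Arguments. Unset Strict Implicit. Unset Printing Implicit Defensive.
Import Order.TTheory GRing.Theory Num.Theory.
Local Open Scope ring_scope.

(** * Union bounds *)

Section UnionBound.
Variables (R : realFieldType) (Omega : finType) (A : {set Omega}).
Implicit Types g : pred Omega.

(** Failures are counted rather than normalised to a probability, so union bounds involve no
    division by [#|A|]. *)
Definition nfail g : R := #|[set w in A | ~~ g w]|%:R.

Lemma nfail_le g g' : (forall w, w \in A -> g' w -> g w) -> nfail g <= nfail g'.
Proof.
move=> gg'; rewrite ler_nat; apply: subset_leq_card; apply/subsetP => w.
rewrite !inE => /andP[wA]; rewrite wA /=; exact/contra/gg'.
Qed.

Lemma nfail_true g : (forall w, w \in A -> g w) -> nfail g = 0.
Proof.
move=> gT; rewrite /nfail (_ : [set _ in _ | _] = set0) ?cards0 //.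
by apply/setP => w; rewrite !inE; apply/andP => -[/gT ->].
Qed.

Lemma nfail_and g g' : nfail (fun w => g w && g' w) <= nfail g + nfail g'.
Proof.
rewrite -natrD ler_nat (leq_trans _ (leq_card_setU _ _)) // subset_leq_card //.
by apply/subsetP => w; rewrite !inE; case: (w \in A) => //; case: (g w).
Qed.

Lemma nfail_and_le g g' c c' :
  nfail g <= c -> nfail g' <= c' -> nfail (fun w => g w && g' w) <= c + c'.
Proof. by move=> gc gc'; apply: le_trans (nfail_and _ _) (lerD gc gc'). Qed.

Lemma nfail_all (T : eqType) (s : seq T) (r : Omega -> pred T) c :
  (forall x, x \in s -> nfail (r^~ x) <= c) ->
  nfail (fun w => all (r w) s) <= (size s)%:R * c.
Proof.
elim: s => [|x s IHs] rc; first by rewrite nfail_true ?mul0r.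
rewrite /= mulrSr mulrDl mul1r addrC; apply: nfail_and_le.
  by apply: rc; rewrite mem_head.
by apply: IHs => y ys; apply: rc; rewrite in_cons ys orbT.
Qed.

Lemma nfail_allrel (T S : eqType) (s : seq T) (t : seq S)
    (r : Omega -> T -> S -> bool) c :
  (forall x y, x \in s -> y \in t -> nfail (fun w => r w x y) <= c) ->
  nfail (fun w => allrel (r w) s t) <= (size s)%:R * ((size t)%:R * c).
Proof.
move=> rc; apply: nfail_all => x xs; apply: nfail_all => y; exact: rc.
Qed.

(** Each unordered pair of positions is tested once, whence the factor 1/2; the induction step has
    slack [c / 2]. The case [x = y] is included since [s] may have repetitions. *)
Lemma nfail_pairwise (T : eqType) (s : seq T) (r : Omega -> rel T) c :
  0 <= c ->
  (forall x y, x \in s -> y \in s -> nfail (fun w => r w x y) <= c) ->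
  nfail (fun w => pairwise (r w) s) <= (size s)%:R ^+ 2 * (c / 2).
Proof.
move=> c0; elim: s => [|x s IHs] rc; first by rewrite nfail_true ?expr0n ?mul0r.
have le1 : nfail (fun w => all (r w x) s) <= (size s)%:R * c.
  by apply: nfail_all => y ys; apply: rc; rewrite ?mem_head // in_cons ys orbT.
have le2 : nfail (fun w => pairwise (r w) s) <= (size s)%:R ^+ 2 * (c / 2).
  by apply: IHs => y z ys zs; apply: rc; rewrite in_cons ?ys ?zs orbT.
rewrite /=; apply: le_trans (nfail_and_le le1 le2) _; rewrite -[(size s).+1%:R]natr1.
by set m : R := _%:R; nra.
Qed.

End UnionBound.

(** * Permutations extending a partial injection *)

Section PermCount.
Variable T : finType.
Implicit Types (s : seq (T * T)) (P : {perm T}).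

Definition extends P s := all (fun p => P p.1 == p.2) s.

Lemma extends_uniq1 P s : extends P s -> uniq s -> uniq (unzip1 s).
Proof.
move=> /allP Ps us; rewrite map_inj_in_uniq // => -[x y] [x' y'] xs ys /= exx.
by have /= /eqP <- := Ps _ xs; have /= /eqP <- := Ps _ ys; rewrite exx.
Qed.

Lemma extends_uniq2 P s : extends P s -> uniq s -> uniq (unzip2 s).
Proof.
move=> /allP Ps us; rewrite map_inj_in_uniq // => -[x y] [x' y'] xs ys /= exx.
have /= /eqP e1 := Ps _ xs; have /= /eqP e2 := Ps _ ys.
by rewrite exx; move: e2; rewrite -exx -e1 => /perm_inj ->.
Qed.

(** Each new pair divides the count by the number of free values: the value at [x] ranges over the
    complement of [unzip2 s], and all these values are equally frequent. *)
Lemma card_extends s : uniq (unzip1 s) -> uniq (unzip2 s) ->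
  #|[set P | extends P s]| = (#|T| - size s)`!.
Proof.
elim: s => [|[x y] s IHs] /=.
  rewrite subn0 -cardsT -card_perm => _ _; apply: eq_card => P.
  by rewrite inE /=; symmetry; apply/subsetP => x _; rewrite inE.
move=> /andP[xs u1] /andP[ys u2]; have {IHs} := IHs u1 u2.
(* Composing with the transposition of [y] and [z] exchanges the two sets, as neither is a value in
   [s]. *)
have swap z : z \notin unzip2 s ->
    #|[set P | extends P ((x, z) :: s)]| = #|[set P | extends P ((x, y) :: s)]|.
  move=> zs; rewrite -(card_imset _ (mulIg (tperm y z))); apply: eq_card => P.
  rewrite -(mulgKV (tperm y z) P) (mem_imset _ _ (mulIg _)) !inE mulgKV tpermV /=.
  rewrite permM -{2}(tpermL y z) (inj_eq perm_inj).
  congr andb; apply: eq_in_all => -[a b] abs /=.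
  have yb : y != b by apply: contraNneq ys => ->; apply: (map_f snd abs).
  have zb : z != b by apply: contraNneq zs => ->; apply: (map_f snd abs).
  by rewrite permM -{1}(tpermD yb zb) (inj_eq perm_inj).
have -> : #|[set P | extends P s]| =
    (\sum_(z in [predC unzip2 s]) #|[set P | extends P ((x, z) :: s)]|)%N.
  rewrite -sum1_card (partition_big (fun P => P x) [in [predC unzip2 s]]) /=.
    apply: eq_bigr => z _; rewrite -sum1_card; apply: eq_bigl => P.
    by rewrite !inE /= andbC.
  move=> P; rewrite !inE => Ps; apply/mapP => -[[a b] abs /= Pxb].
  have /allP/(_ _ abs)/eqP/= Pab := Ps.
  by case/negP: xs; rewrite (perm_inj (etrans Pxb (esym Pab))) (map_f fst abs).
rewrite (eq_bigr _ swap) sum_nat_const.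
have -> : #|[predC unzip2 s]| = (#|T| - size s)%N.
  by have := cardC [in unzip2 s]; rewrite (card_uniqP u2) size_map => <-; rewrite addKn.
have : (size s < #|T|)%N.
  by have := max_card [in x :: unzip1 s]; rewrite (card_uniqP _) /= ?xs ?size_map.
rewrite subnS -subn_gt0; case: (_ - _)%N => // m _ /=.
by rewrite factS => /eqP; rewrite eqn_pmul2l // => /eqP.
Qed.

End PermCount.

(** * Prescribed pairs that depend on the permutation *)

Section DependentExtension.
Variable T : finType.
Implicit Types (F : seq (T * T)) (U : seq T) (P : {perm T}).

Lemma extends_cat P F F' : extends P (F ++ F') = extends P F && extends P F'.
Proof. exact: all_cat. Qed.

Lemma extends_graph P P' U :
  extends P [seq (u, P' u) | u <- U] = ([seq P u | u <- U] == [seq P' u | u <- U]).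
Proof.
rewrite /extends all_map; apply/allP/eqP => [PP'|/eq_in_map PP' u uU].
  by apply/eq_in_map => u /PP' /eqP.
by apply/eqP/PP'.
Qed.

(** Permutations are grouped by their values on [U]. Within a group [g] and [M] are constant, so
    [card_extends] gives [(#|T| - a)!] before and [(#|T| - a - m)!] after imposing [M], where
    [a = size F + size U]; the ratio is the same for all groups. *)
Lemma card_extends_dep F U (g : pred {perm T}) (M : {perm T} -> seq (T * T)) m :
  (forall P P', {in U, P =1 P'} -> (g P = g P') * (M P = M P')) ->
  (forall P, size (M P) = m) ->
  (forall P, extends P F -> g P ->
     let L := (F ++ [seq (u, P u) | u <- U]) ++ M P in
     uniq (unzip1 L) && uniq (unzip2 L)) ->
  (#|[set P | [&& extends P F, g P & extends P (M P)]]|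
     * (#|T| - (size F + size U)) ^_ m = #|[set P | extends P F && g P]|)%N.
Proof.
move=> dep szM fresh; pose v P := [tuple of map P (in_tuple U)].
rewrite -[X in (X * _)%N]sum1_card -[RHS]sum1_card.
rewrite [in RHS](partition_big v predT) // [in LHS](partition_big v predT) //=.
rewrite big_distrl /=; apply: eq_bigr => t _.
(* [P0] represents its group; a group without representative contributes 0 to both sides. *)
case: (pickP [pred P | [&& extends P F, g P & v P == t]]) => [P0 /= /and3P[PF gP /eqP <-]|none].
  have vE P : (v P == v P0) = extends P [seq (u, P0 u) | u <- U].
    by rewrite extends_graph -val_eqE.
  have eqU P : v P == v P0 -> {in U, P =1 P0} by move=> /eqP/(congr1 val)/eq_in_map.
  have /andP[] := fresh _ PF gP.
  set L := _ ++ _ => u1 u2.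
  have := u1; rewrite /L /unzip1 map_cat cat_uniq -/unzip1 => /andP[u1' _].
  have := u2; rewrite /L /unzip2 map_cat cat_uniq -/unzip2 => /andP[u2' _].
  have szL : (size L <= #|T|)%N.
    by rewrite -(size_map fst) -(card_uniqP u1) max_card.
  have -> : (\sum_(P in [set P | extends P F && g P] | v P == v P0) 1 =
      (#|T| - (size F + size U))`!)%N.
    have := card_extends u1' u2'; rewrite size_cat size_map => <-.
    rewrite -sum1_card; apply: eq_bigl => P; rewrite !inE extends_cat -vE.
    case: (boolP (v P == _)) => vP; last by rewrite !andbF.
    by rewrite (dep _ _ (eqU _ vP)) gP !andbT.
  have -> : (\sum_(P in [set P | [&& extends P F, g P & extends P (M P)]] | v P == v P0) 1 =
      (#|T| - (size F + size U) - m)`!)%N.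
    have := card_extends u1 u2; rewrite /L !size_cat size_map szM subnDA => <-.
    rewrite -sum1_card; apply: eq_bigl => P; rewrite !inE !extends_cat -vE.
    case: (boolP (v P == _)) => vP; last by rewrite !andbF.
    by rewrite !(dep _ _ (eqU _ vP)) gP !andbT.
  rewrite mulnC ffact_fact //.
  by move: szL => /(leq_sub2r (size F + size U)); rewrite /L !size_cat size_map szM addKn.
rewrite !big_pred0 ?mul0n // => P; rewrite !inE; have /= := none P.
  by case: extends; case: (g P); case: (v P == t); rewrite ?andbF.
by case: extends; case: (g P); case: (v P == t); rewrite ?andbF.
Qed.

End DependentExtension.

(** * Families of permutations extending a log *)

Section PermFamilies.
Variables I T : finType.
Implicit Types (E : {ffun I -> {perm T}}) (Q : seq (I * T * T)) (e : I * T * T).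

Definition fam_extends (E : I -> {perm T}) Q := all (fun e => E e.1.1 e.1.2 == e.2) Q.

Lemma fam_extendsP (E : I -> {perm T}) Q :
  reflect (forall e, e \in Q -> E e.1.1 e.1.2 = e.2) (fam_extends E Q).
Proof. by apply: (iffP allP) => EQ e /EQ /eqP. Qed.

(** At the index of [e] at least [#|T| - size Q] values are free, and each is at least as frequent
    as the output of [e]. Entries at other indices are counted as if they used up values too. *)
Lemma card_fam_extends_fresh e Q : e \notin Q ->
  (#|[set E : {ffun I -> {perm T}} | fam_extends E (e :: Q)]| * (#|T| - size Q)
     <= #|[set E : {ffun I -> {perm T}} | fam_extends E Q]|)%N.
Proof.
case: e => [[d x] y] eQ; pose used := [seq e.2 | e <- Q & e.1.1 == d].
(* An entry of [Q] with the same index and the same input or output contradicts [e], because [e] is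
   not in [Q]; the count is then 0. *)
case: (boolP (has (fun e => [&& e.1.1 == d & (e.1.2 == x) || (e.2 == y)]) Q)).
  move=> /hasP[[[d' x'] y'] e'Q /= /andP[/eqP dd xy]]; rewrite {d'}dd in e'Q.
  rewrite (_ : [set _ | _] = set0) ?cards0 //; apply/setP => E; rewrite !inE /=.
  apply/negP => /andP[/eqP Exy /allP/(_ _ e'Q)/eqP/= Ex'y'].
  case/orP: xy => /eqP xy; move: eQ; rewrite -Exy -?Ex'y' ?xy.
    by rewrite -xy Ex'y' e'Q.
  move: Ex'y'; rewrite xy -Exy => /perm_inj ex.
  by rewrite Exy -xy -ex e'Q.
move=> /hasPn fresh.
have swap z : z \notin used ->
    (#|[set E : {ffun I -> {perm T}} | fam_extends E ((d, x, y) :: Q)]|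
       <= #|[set E : {ffun I -> {perm T}} | (E d x == z) && fam_extends E Q]|)%N.
  move=> zu; pose f E := [ffun i => if i == d then (E i * tperm y z)%g else E i].
  have fI : injective f.
    move=> E E' /ffunP ff; apply/ffunP => i; have := ff i; rewrite !ffunE.
    by case: eqP => // _ /mulIg.
  rewrite -(card_imset _ fI); apply: subset_leq_card; apply/subsetP => _ /imsetP[E EA ->].
  move: EA; rewrite !inE /= => /andP[/eqP Exy /fam_extendsP EQ].
  rewrite ffunE eqxx permM Exy tpermL eqxx /=; apply/fam_extendsP => e eQ'.
  rewrite ffunE; case: eqP => [ed|_]; last exact: EQ.
  rewrite permM EQ // tpermD //.
    by have := fresh _ eQ'; rewrite /= ed eqxx /= negb_or => /andP[_]; rewrite eq_sym.
  by apply: contraNneq zu => ->; apply: map_f; rewrite mem_filter ed eqxx.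
have le_used : (#|T| - size Q <= #|[predC used]|)%N.
  rewrite leq_subLR -(cardC [in used]) leq_add //.
  by rewrite (leq_trans (card_size used)) // size_map size_filter count_size.
apply: leq_trans (leq_mul (leqnn _) le_used) _.
rewrite mulnC -[leqLHS]sum_nat_const.
apply: (@leq_trans (\sum_(z in [predC used])
  #|[set E : {ffun I -> {perm T}} | (E d x == z) && fam_extends E Q]|)).
  exact: leq_sum.
rewrite -[leqRHS]sum1_card (partition_big (fun E => E d x) predT) //=.
rewrite [leqRHS](bigID [in [predC used]]) /=.
apply: leq_trans (leq_addr _ _); apply: leq_sum => z _; rewrite -sum1_card.
by rewrite leq_eqVlt; apply/orP; left; apply/eqP/eq_bigl => E; rewrite !inE andbC.
Qed.

Lemma card_fam_extends Q : uniq Q ->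
  (#|[set E : {ffun I -> {perm T}} | fam_extends E Q]| * #|T| ^_ (size Q) <= #|{ffun I -> {perm T}}|)%N.
Proof.
elim: Q => [|e Q IHQ] /=; first by rewrite ffactn0 muln1 max_card.
move=> /andP[eQ /IHQ]; apply: leq_trans; rewrite ffactnSr mulnCA mulnC.
by rewrite leq_mul2r card_fam_extends_fresh ?orbT.
Qed.

End PermFamilies.

(** The factors pair up as [(M - 2 i) (M - 2 i - 1) <= N ^ 2 - i]: two values of [P] are compared
    with one block of the ideal cipher. *)
Lemma ffact_double_le M N q : (M <= N)%N -> (M ^_ (2 * q) <= (N ^ 2) ^_ q)%N.
Proof.
move=> MN; elim: q => [|q IHq]; first by rewrite !ffactn0.
rewrite mulnS !ffactnSr -mulnA; apply: leq_mul => //; nia.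
Qed.

(** * One fresh value of a permutation *)

Section FreshValues.
Variable T : finType.
Implicit Types (F : seq (T * T)) (P : {perm T}).

(** If [c] is already a value in [F], no permutation is left; otherwise [card_extends] gives
    equality. *)
Lemma card_extends_fresh F u c : uniq (unzip1 F) -> u \notin unzip1 F ->
  (#|[set P | extends P ((u, c) :: F)]| * (#|T| - size F)
     <= #|[set P | extends P F]|)%N.
Proof.
move=> uF uu; have uF' : uniq (unzip1 ((u, c) :: F)) by rewrite /= uu.
case: (boolP (uniq (unzip2 ((u, c) :: F)))) => [uF2|/negP not_u]; last first.
  rewrite (_ : [set _ | _] = set0) ?cards0 //; apply/setP => P; rewrite !inE.
  apply/negP => PF; apply: not_u; apply: extends_uniq2 PF _; exact: map_uniq uF'.
rewrite !card_extends //; last by case/andP: uF2.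
have : (size F < #|T|)%N.
  by have := max_card [in unzip1 ((u, c) :: F)]; rewrite (card_uniqP uF') size_map.
rewrite subnS -subn_gt0; case: (_ - _)%N => // m _ /=.
by rewrite factS mulnC.
Qed.

End FreshValues.

(** * The two middle rounds *)

Section MiddleRounds.
Variables (R : realFieldType) (T : finZmodType) (J : eqType).
Variables (F : seq (T * T)) (Q : seq J) (u1 u4 a2 b2 a3 b3 : J -> T).
Hypotheses (uF : uniq F) (uQ : uniq Q).
Hypothesis sizes : (2 * (size F + 2 * size Q) <= #|T|)%N.
Hypothesis u1F : {in Q, forall e, u1 e \notin unzip1 F}.
Hypothesis u4F : {in Q, forall e, u4 e \notin unzip1 F}.
Hypothesis u14 : {in Q &, forall e e', u1 e != u4 e'}.
(** Entries with equal [u1] share the unknown [P (u1 e)], so their round-2 inputs and round-3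
    outputs are separated by [a2] and [b3] alone, whatever [P] is. [u4_eq] is the analogue for
    [P (u4 e)]. *)
Hypothesis u1_eq : {in Q &, forall e e', e != e' -> u1 e = u1 e' ->
  (a2 e != a2 e') && (b3 e != b3 e')}.
Hypothesis u4_eq : {in Q &, forall e e', e != e' -> u4 e = u4 e' ->
  (b2 e != b2 e') && (a3 e != a3 e')}.
(** If [b2 e = 0], the round-2 output [b2 e + P (u4 e)] would repeat the round-4 output [P (u4 e)];
    likewise [b3] with rounds 3 and 1. *)
Hypothesis b_neq0 : {in Q, forall e, (b2 e != 0) && (b3 e != 0)}.
Implicit Types P : {perm T}.

Let x2 P e := a2 e + P (u1 e).
Let y2 P e := b2 e + P (u4 e).
Let x3 P e := a3 e + P (u4 e).
Let y3 P e := b3 e + P (u1 e).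

Definition middle P : seq (T * T) :=
  [seq (a2 e + P (u1 e), b2 e + P (u4 e)) | e <- Q] ++
  [seq (a3 e + P (u4 e), b3 e + P (u1 e)) | e <- Q].

Let U := undup ([seq u1 e | e <- Q] ++ [seq u4 e | e <- Q]).
Let A := [set P | extends P F].
(** Bounds the number of permutations in [A] that satisfy one equation on a fresh value: at least
    half of the points remain possible for that value. *)
Let beta : R := 2 * #|A|%:R / #|T|%:R.

Let T_gt0 : (0 < #|T|%:R :> R).
Proof. by rewrite ltr0n; apply/card_gt0P; exists 0. Qed.

Let beta_ge0 : 0 <= beta.
Proof. by rewrite divr_ge0 ?mulr_ge0 ?ler0n. Qed.

Let le_beta (e : J) m : e \in Q -> (m * (#|T| - (size F).+1) <= #|A|)%N -> m%:R <= beta.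
Proof.
move=> eQ mA; rewrite ler_pdivlMr // -natrM -natrM ler_nat.
(* The entry [e] makes [Q] nonempty, so [sizes] leaves room for the extra point in [(size F).+1]. *)
have Q_gt0 : (0 < size Q)%N by case: Q eQ.
have : (#|T| <= 2 * (#|T| - (size F).+1))%N by move: sizes Q_gt0; lia.
by move: (#|T| - _)%N mA => t mA; nia.
Qed.

Let nfail_point e u c (g : pred {perm T}) : e \in Q -> u \notin unzip1 F ->
  (forall P, P u != c -> g P) -> nfail R A g <= beta.
Proof.
move=> eQ uu Pu; apply: le_beta eQ _.
have [A0|/set0Pn[P0]] := eqVneq A set0; first by rewrite setIdE A0 set0I cards0.
rewrite inE => P0F; have u1F' := extends_uniq1 P0F uF.
apply: leq_trans (card_extends_fresh c u1F' uu); apply: leq_mul; last by rewrite subnS leq_pred.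
apply: subset_leq_card; apply/subsetP => P; rewrite !inE /= andbC => /andP[gP ->].
by rewrite andbT; apply: contraNT gP; apply: Pu.
Qed.

(** Once [P u' = z] is fixed, the equation prescribes the single value [c + z] at the fresh point
    [u]; the bound is then summed over [z]. *)
Let nfail_pair e u u' c (g : pred {perm T}) : e \in Q ->
  u \notin unzip1 F -> u' \notin unzip1 F -> u != u' ->
  (forall P, P u != c + P u' -> g P) -> nfail R A g <= beta.
Proof.
move=> eQ uu uu' neq Pu; apply: le_beta eQ _.
have [A0|/set0Pn[P0]] := eqVneq A set0; first by rewrite setIdE A0 set0I cards0.
rewrite inE => P0F; have u1F' := extends_uniq1 P0F uF.
have AE : #|A| = (\sum_z #|[set P | extends P ((u', z) :: F)]|)%N.
  rewrite -sum1_card (partition_big (fun P => P u') predT) //=.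
  by apply: eq_bigr => z _; rewrite -sum1_card; apply: eq_bigl => P; rewrite !inE andbC.
have le_sum : (#|[set P in A | ~~ g P]|
    <= \sum_z #|[set P | extends P [:: (u, (c + z)%R), (u', z) & F]]|)%N.
  rewrite -sum1_card (partition_big (fun P => P u') predT) //=.
  apply: leq_sum => z _; rewrite sum1_card; apply: subset_leq_card; apply/subsetP => P.
  rewrite unfold_in !inE => /andP[/andP[PF gP] /eqP <-]; rewrite /= eqxx PF !andbT.
  by apply: contraNT gP; apply: Pu.
rewrite AE; apply: leq_trans (leq_mul le_sum (leqnn _)) _.
rewrite big_distrl /=; apply: leq_sum => z _.
apply: (@card_extends_fresh _ ((u', z) :: F)); rewrite /= ?uu' //.
by rewrite inE negb_or neq.
Qed.

(** Three families of tests cover the coincidences of middle points: with [F], with outer points or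
    the other middle round, and within one middle round. They have 4, 10 and 4 tests per pair, the
    last over unordered pairs, so [beta] is paid [4 q m + 12 q^2] times for [q] entries and [m]
    pairs in [F]. *)
Let fresh_dom P := allrel (fun e f =>
  [&& x2 P e != f.1, x3 P e != f.1, y2 P e != f.2 & y3 P e != f.2]) Q F.

Let fresh_outer P := allrel (fun e e' =>
  [&& [&& x2 P e != u1 e', x2 P e != u4 e', x3 P e != u1 e' & x3 P e != u4 e'],
      [&& y2 P e != P (u1 e'), y2 P e != P (u4 e'), y3 P e != P (u1 e') & y3 P e != P (u4 e')],
      x2 P e != x3 P e' & y2 P e != y3 P e']) Q Q.

Let fresh_pairs P := pairwise (fun e e' => (e == e') ||
  [&& x2 P e != x2 P e', x3 P e != x3 P e', y2 P e != y2 P e' & y3 P e != y3 P e']) Q.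

Let nfail_const e a u c : e \in Q -> u \notin unzip1 F ->
  nfail R A (fun P => a + P u != c) <= beta.
Proof.
move=> eQ uu; apply: (nfail_point (c := c - a)) eQ uu _ => P.
by apply: contraNneq => <-; rewrite addrAC subrr add0r.
Qed.

Let nfail_shift e a u a' u' : e \in Q -> u \notin unzip1 F -> u' \notin unzip1 F ->
  u != u' -> nfail R A (fun P => a + P u != a' + P u') <= beta.
Proof.
move=> eQ uu uu' neq; apply: (nfail_pair (c := a' - a)) eQ uu uu' neq _ => P.
by apply: contraNneq => eq; rewrite addrAC -eq addrAC subrr add0r.
Qed.

Let nfail_image e a u u' : e \in Q -> u \notin unzip1 F -> u' \notin unzip1 F ->
  a != 0 -> nfail R A (fun P => a + P u != P u') <= beta.
Proof.
move=> eQ uu uu' a0; have [<-|neq] := eqVneq u u'.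
  rewrite nfail_true // => P _; apply: contra_neq a0 => /eqP.
  by rewrite -subr_eq0 addrK => /eqP.
apply: (nfail_pair (c := - a)) eQ uu uu' neq _ => P.
by apply: contraNneq => <-; rewrite addKr.
Qed.

Let nfail_fresh_dom : nfail R A fresh_dom <= (size Q)%:R * ((size F)%:R * (4 * beta)).
Proof.
apply: nfail_allrel => e f eQ fF.
have -> : 4 * beta = beta + (beta + (beta + beta)) by ring.
by do !apply: nfail_and_le; apply: (nfail_const _ _ eQ); rewrite ?u1F ?u4F.
Qed.

Let nfail_fresh_outer : nfail R A fresh_outer <= (size Q)%:R * ((size Q)%:R * (10 * beta)).
Proof.
apply: nfail_allrel => e e' eQ e'Q.
have -> : 10 * beta = (beta + (beta + (beta + beta)))
   + ((beta + (beta + (beta + beta))) + (beta + beta)) by ring.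
have /andP[b2_neq0 b3_neq0] := b_neq0 eQ.
do !apply: nfail_and_le; do 1?[by apply: (nfail_const _ _ eQ); rewrite ?u1F ?u4F];
  do 1?[by apply: (nfail_image eQ); rewrite ?u1F ?u4F].
  (* The two remaining tests compare rounds 2 and 3, which use [P] at a round-1 and at a round-4
     input; these differ even for [e = e']. *)
  by apply: (nfail_shift _ _ eQ); rewrite ?u1F ?u4F ?u14.
by apply: (nfail_shift _ _ eQ); rewrite ?u1F ?u4F // eq_sym u14.
Qed.

Let nfail_fresh_pairs : nfail R A fresh_pairs <= (size Q)%:R ^+ 2 * (4 * beta / 2).
Proof.
apply: nfail_pairwise => [|e e' eQ e'Q]; first exact: mulr_ge0 (ler0n _ 4) beta_ge0.
have [<-|neq] := eqVneq e e'.
  by rewrite nfail_true => [|P _]; [exact: mulr_ge0 (ler0n _ 4) beta_ge0 | rewrite eqxx].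
have -> : 4 * beta = beta + (beta + (beta + beta)) by ring.
(* If both sides use the same value of [P], it cancels and the test reduces to [a != a']. *)
have pair a a' (u u' : T) : u \notin unzip1 F -> u' \notin unzip1 F ->
    (u = u' -> a != a') -> nfail R A (fun P => a + P u != a' + P u') <= beta.
  move=> uu uu' aa; have [eq|neq'] := eqVneq u u'; last exact: (nfail_shift _ _ eQ).
  rewrite nfail_true // => P _; rewrite eq; apply: contra_neq (aa eq); exact: addIr.
apply: le_trans (nfail_le (g' := fun P => [&& x2 P e != x2 P e', x3 P e != x3 P e',
  y2 P e != y2 P e' & y3 P e != y3 P e']) _ _) _ => [P _ ->|]; first exact: orbT.
do !apply: nfail_and_le; apply: pair; rewrite ?u1F ?u4F //.
- by case/(u1_eq eQ e'Q neq)/andP.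
- by case/(u4_eq eQ e'Q neq)/andP.
- by case/(u4_eq eQ e'Q neq)/andP.
- by case/(u1_eq eQ e'Q neq)/andP.
Qed.

Let valid P := let L := (F ++ [seq (u, P u) | u <- U]) ++ middle P in
  uniq (unzip1 L) && uniq (unzip2 L).

Let UP u : u \in U -> exists2 e, e \in Q & (u == u1 e) || (u == u4 e).
Proof.
rewrite mem_undup mem_cat => /orP[] /mapP[e eQ ->]; exists e => //; rewrite eqxx ?orbT //.
Qed.

(** Coincidences that involve no middle point are excluded because [P] is injective, extends [F],
    and [U] avoids the inputs in [F]; the three tests exclude the others. *)
Let fresh_valid P : P \in A -> [&& fresh_dom P, fresh_outer P & fresh_pairs P] -> valid P.
Proof.
rewrite inE => PF /and3P[/allrelP dom /allrelP outer].
rewrite /fresh_pairs pairwise_all2rel => [/allrelP pairs|e|e e']; last first.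
- rewrite eq_sym (eq_sym (x2 P e)) (eq_sym (x3 P e)) (eq_sym (y2 P e)).
  by rewrite (eq_sym (y3 P e)).
- by rewrite eqxx.
have inj (v : J -> T) : (forall e e', e \in Q -> e' \in Q -> e != e' -> v e != v e') ->
    uniq [seq v e | e <- Q].
  move=> vv; rewrite map_inj_in_uniq // => e e' eQ e'Q eq.
  by apply: contra_eq eq; apply: vv.
have pairs' e e' : e \in Q -> e' \in Q -> e != e' -> [&& x2 P e != x2 P e',
    x3 P e != x3 P e', y2 P e != y2 P e' & y3 P e != y3 P e'].
  by move=> eQ e'Q neq; have := pairs _ _ eQ e'Q; rewrite (negPf neq).
have UF u : u \in U -> u \notin unzip1 F.
  by case/UP => e eQ /orP[] /eqP ->; rewrite ?u1F ?u4F.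
rewrite /valid /unzip1 /unzip2 /middle !map_cat -!map_comp /=.
apply/andP; split; rewrite !cat_uniq; apply/and3P; split.
- rewrite (extends_uniq1 PF uF) map_id undup_uniq andbT.
  by apply/hasPn => u; exact: UF.
- apply/hasPn => x; rewrite !mem_cat map_id negb_or => xx.
  apply/andP; split.
    apply/negP => /mapP[f fF xf]; case/orP: xx => /mapP[e eQ xe].
      by have /and4P[] := dom _ _ eQ fF; rewrite -xf xe /= eqxx.
    by have /and4P[_] := dom _ _ eQ fF; rewrite -xf xe /= eqxx.
  apply/negP => /UP[e' e'Q] xe'; case/orP: xx => /mapP[e eQ xe];
  have /and3P[/and4P[o1 o2 o3 o4] _ _] := outer _ _ eQ e'Q; case/orP: xe' => /eqP xe';
  by move: o1 o2 o3 o4; rewrite -xe' xe /x2 /x3 eqxx.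
- apply/and3P; split.
  + by apply: inj => e e' eQ e'Q neq; have /and4P[] := pairs' _ _ eQ e'Q neq.
  + apply/hasPn => x /mapP[e' e'Q ->]; apply/negP => /mapP[e eQ /= eq].
    have /and3P[_ _ /andP[]] := outer _ _ eQ e'Q.
    by rewrite /x2 /x3 -eq eqxx.
  + by apply: inj => e e' eQ e'Q neq; have /and4P[] := pairs' _ _ eQ e'Q neq.
- rewrite (extends_uniq2 PF uF) (map_inj_uniq perm_inj) undup_uniq andbT /=.
  apply/hasPn => y /mapP[u uU ->]; apply/negP => /mapP[f fF eq].
  case/negP: (UF _ uU); apply/mapP; exists f => //.
  by have /allP/(_ _ fF)/eqP := PF; rewrite -eq => /perm_inj.
- apply/hasPn => x; rewrite !mem_cat negb_or => xx.
  apply/andP; split.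
    apply/negP => /mapP[f fF xf]; case/orP: xx => /mapP[e eQ xe];
    have /and4P[_ _ d1 d2] := dom _ _ eQ fF;
    by move: d1 d2; rewrite -xf xe /y2 /y3 /= eqxx.
  apply/negP => /mapP[u /UP[e' e'Q] ue' /= xu]; case/orP: xx => /mapP[e eQ xe];
  have /and3P[_ /and4P[o1 o2 o3 o4] _] := outer _ _ eQ e'Q; case/orP: ue' => /eqP ue';
  by move: o1 o2 o3 o4; rewrite -ue' -xu xe /y2 /y3 /= eqxx.
- apply/and3P; split.
  + by apply: inj => e e' eQ e'Q neq; have /and4P[] := pairs' _ _ eQ e'Q neq.
  + apply/hasPn => x /mapP[e' e'Q ->]; apply/negP => /mapP[e eQ /= eq].
    have /and3P[_ _ /andP[_]] := outer _ _ eQ e'Q.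
    by rewrite /y2 /y3 -eq eqxx.
  + by apply: inj => e e' eQ e'Q neq; have /and4P[] := pairs' _ _ eQ e'Q neq.
Qed.

(** The subtracted fraction bounds the share of [A] where [valid] fails. On the rest, the
    [2 * size Q] middle pairs are fresh, and [ffact_double_le] compares their cost with that of
    [size Q] ideal blocks. *)
Lemma card_extends_middle :
  (1 - (8 * (size Q)%:R * (size F)%:R + 24 * (size Q)%:R ^+ 2) / #|T|%:R) * #|A|%:R
  <= (#|[set P | extends P F && extends P (middle P)]| * (#|T| ^ 2) ^_ (size Q))%:R :> R.
Proof.
have bound : nfail R A valid <=
    (8 * (size Q)%:R * (size F)%:R + 24 * (size Q)%:R ^+ 2) / #|T|%:R * #|A|%:R.
  apply: le_trans (nfail_le R fresh_valid) _.
  apply: le_trans (nfail_and_le nfail_fresh_dom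
    (nfail_and_le nfail_fresh_outer nfail_fresh_pairs)) _.
  rewrite /beta le_eqVlt; apply/orP; left; apply/eqP; field.
  exact: lt0r_neq0.
have dep P P' : {in U, P =1 P'} -> (valid P = valid P') * (middle P = middle P').
  move=> PP'; have eqM : middle P = middle P'.
    have in1 e : e \in Q -> P (u1 e) = P' (u1 e).
      by move=> eQ; apply: PP'; rewrite mem_undup mem_cat map_f.
    have in4 e : e \in Q -> P (u4 e) = P' (u4 e).
      by move=> eQ; apply: PP'; rewrite mem_undup mem_cat (map_f u4) ?orbT.
    by congr (_ ++ _); apply/eq_in_map => e eQ; rewrite in1 ?in4.
  split=> //; rewrite /valid eqM.
  suff -> : [seq (u, P u) | u <- U] = [seq (u, P' u) | u <- U] by [].
  by apply/eq_in_map => u uU; rewrite PP'.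
have szM P : size (middle P) = (2 * size Q)%N.
  by rewrite size_cat !size_map mul2n addnn.
(* With [g := valid], the freshness condition is [valid] itself. *)
have := card_extends_dep dep szM (fun P _ v => v).
set k1 := #|_|; set k2 := #|_| => ck.
have cA : #|A|%:R = nfail R A valid + k2%:R :> R.
  rewrite /nfail /k2 -natrD addnC -(cardsID [set P | valid P] A).
  by congr (_ + _)%:R; apply: eq_card => P; rewrite !inE // andbC.
rewrite mulrBl mul1r {1}cA; apply: (@le_trans _ _ k2%:R).
  by rewrite lerBlDr addrC lerD2l.
rewrite ler_nat -ck; apply: leq_mul.
  apply: subset_leq_card; apply/subsetP => P; rewrite !inE.
  by case/and3P=> -> _ ->.
by apply: ffact_double_le; exact: leq_subr.
Qed.

End MiddleRounds.

(** * Sums over transcripts *)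

Section TranscriptSums.
Variables (R : realFieldType) (n : nat).
Notation F_log := (seq (B n * B n)).
Notation E_log := (seq (B n * (B n * B n) * (B n * B n))).
Implicit Types (D : dist n) (F : F_log) (Q : E_log) (h : F_log -> E_log -> bool -> R).

(* Sum of h over all the transcripts of D extending the transcript (F, Q); F records
   the pairs (x, f x) and Q the triples (Delta, plaintext, ciphertext). *)
Fixpoint tsum h D F Q : R :=
  match D with
  | DOut b => h F Q b
  | DCoin c => (tsum h (c true) F Q + tsum h (c false) F Q) / 2
  | DQf x c => \sum_y tsum h (c y) ((x, y) :: F) Q
  | DQfinv y c => \sum_x tsum h (c x) ((x, y) :: F) Q
  | DQe d W c => \sum_C tsum h (c C) F ((d, W, C) :: Q)
  | DQeinv d C c => \sum_W tsum h (c W) F ((d, W, C) :: Q)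
  end.

(** Every leaf is reached with logs within the query budget, so the comparison is required only
    there. *)
Lemma tsum_le (mf me : nat) h h' D F Q qf qe :
  (forall F Q b, (size F <= mf)%N -> (size Q <= me)%N -> h F Q b <= h' F Q b) ->
  queries_ok D qf qe -> (size F + qf <= mf)%N -> (size Q + qe <= me)%N ->
  tsum h D F Q <= tsum h' D F Q.
Proof.
move=> hh; elim: D F Q qf qe => [b|c IH|x c IH|y c IH|d W c IH|d C c IH] F Q qf qe /=.
- by move=> _ sF sQ; apply: hh; lia.
- by move=> ok sF sQ; rewrite ler_wpM2r ?invr_ge0 ?ler0n // lerD // (IH _ _ _ qf qe).
- move=> [qf0 ok] sF sQ; apply: ler_sum => y _.
  by apply: (IH _ _ _ qf.-1 qe) => //=; lia.
- move=> [qf0 ok] sF sQ; apply: ler_sum => x _.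
  by apply: (IH _ _ _ qf.-1 qe) => //=; lia.
- move=> [qe0 ok] sF sQ; apply: ler_sum => C _.
  by apply: (IH _ _ _ qf qe.-1) => //=; lia.
- move=> [qe0 ok] sF sQ; apply: ler_sum => W _.
  by apply: (IH _ _ _ qf qe.-1) => //=; lia.
Qed.

Lemma tsum_comb (I : finType) (a : I -> R) (H : I -> F_log -> E_log -> bool -> R) D F Q :
  tsum (fun F Q b => \sum_i a i * H i F Q b) D F Q = \sum_i a i * tsum (H i) D F Q.
Proof.
have swap (J : finType) (G : I -> J -> R) :
    \sum_j \sum_i a i * G i j = \sum_i a i * \sum_j G i j.
  by rewrite exchange_big; apply: eq_bigr => i _; rewrite mulr_sumr.
elim: D F Q => [b|c IH|x c IH|y c IH|d W c IH|d C c IH] F Q //=.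
- rewrite !IH -big_split mulr_suml; apply: eq_bigr => i _ /=.
  by rewrite -mulrDr mulrA.
- by rewrite -swap; apply: eq_bigr => y _; rewrite IH.
- by rewrite -swap; apply: eq_bigr => x _; rewrite IH.
- by rewrite -swap; apply: eq_bigr => C _; rewrite IH.
- by rewrite -swap; apply: eq_bigr => W _; rewrite IH.
Qed.

Lemma eq_tsum h h' D F Q : (forall F Q b, h F Q b = h' F Q b) -> tsum h D F Q = tsum h' D F Q.
Proof.
move=> hh; elim: D F Q => [b|c IH|x c IH|y c IH|d W c IH|d C c IH] F Q //=.
- by rewrite !IH.
- by apply: eq_bigr => y _; rewrite IH.
- by apply: eq_bigr => x _; rewrite IH.
- by apply: eq_bigr => C _; rewrite IH.
- by apply: eq_bigr => W _; rewrite IH.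
Qed.

Lemma tsumD h h' D F Q :
  tsum (fun F Q b => h F Q b + h' F Q b) D F Q = tsum h D F Q + tsum h' D F Q.
Proof.
transitivity (tsum (fun F Q b => \sum_(i : bool) 1 * (if i then h else h') F Q b) D F Q).
  by apply: eq_tsum => F' Q' b; rewrite big_bool /= !mul1r.
by rewrite tsum_comb big_bool /= !mul1r.
Qed.

Lemma tsumZ a h D F Q : tsum (fun F Q b => a * h F Q b) D F Q = a * tsum h D F Q.
Proof.
transitivity (tsum (fun F Q b => \sum_(i : unit) a * h F Q b) D F Q).
  by apply: eq_tsum => F' Q' b; rewrite big_const card_unit /= addr0.
by rewrite (tsum_comb (fun _ : unit => a) (fun _ => h)) big_const card_unit /= addr0.
Qed.

Lemma eq_run D f f' finv finv' e e' einv einv' :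
  f =1 f' -> finv =1 finv' -> e =2 e' -> einv =2 einv' ->
  run R D f finv e einv = run R D f' finv' e' einv'.
Proof.
move=> ff fi ee ei; elim: D => [b|c IH|x c IH|y c IH|d W c IH|d C c IH] //=.
- by rewrite !IH.
- by rewrite ff IH.
- by rewrite fi IH.
- by rewrite ee IH.
- by rewrite ei IH.
Qed.

Definition perm_run D (P : {perm B n}) (E : B n -> {perm B n * B n}) : R :=
  run R D (fun x => P x) (fun y => (P^-1)%g y) (fun d W => E d W) (fun d C => ((E d)^-1)%g C).

(** * Counting the worlds compatible with a transcript *)

Section Worlds.
Variables (Omega : finType) (p : Omega -> {perm B n}) (E : Omega -> B n -> {perm B n * B n}).

(** [Omega] is instantiated by the permutations, for the real world at a fixed key, and by pairs of
    a permutation and a cipher family, for the ideal world. *)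
Definition compat F Q w := extends (p w) F && fam_extends (E w) Q.

Definition ncompat F Q : R := #|[set w | compat F Q w]|%:R.

Lemma sum_split (V : finType) (v : Omega -> V) (A : pred Omega) (G : V -> Omega -> R) :
  \sum_(w | A w) G (v w) w = \sum_x \sum_(w | (v w == x) && A w) G x w.
Proof.
rewrite (partition_big v predT) //=; apply: eq_bigr => x _.
rewrite (eq_bigl (fun w => (v w == x) && A w)) => [|w]; last exact: andbC.
by apply: eq_bigr => w /andP[/eqP -> _].
Qed.

Lemma compat_f F Q x y w : compat ((x, y) :: F) Q w = (p w x == y) && compat F Q w.
Proof. by rewrite /compat /extends /= andbA. Qed.

Lemma compat_finv F Q x y w : compat ((x, y) :: F) Q w = ((p w)^-1%g y == x) && compat F Q w.
Proof. by rewrite compat_f -(inj_eq (@perm_inj _ (p w)) _ x) permKV eq_sym. Qed.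

Lemma compat_e F Q d W C w : compat F ((d, W, C) :: Q) w = (E w d W == C) && compat F Q w.
Proof. by rewrite /compat /= andbCA. Qed.

Lemma compat_einv F Q d W C w :
  compat F ((d, W, C) :: Q) w = ((E w d)^-1%g C == W) && compat F Q w.
Proof. by rewrite compat_e -(inj_eq (@perm_inj _ (E w d)) _ W) permKV eq_sym. Qed.

(** The answers to a query partition the compatible worlds, so each world follows one branch, and
    coins are averaged on both sides. *)
Lemma tsum_run D F Q :
  tsum (fun F Q b => ncompat F Q * (b : nat)%:R) D F Q =
  \sum_(w | compat F Q w) perm_run D (p w) (E w).
Proof.
elim: D F Q => [b|c IH|x c IH|y c IH|d W c IH|d C c IH] F Q; rewrite /perm_run /=.
- rewrite sumr_const mulr_natl; congr (_ *+ _).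
  by apply: eq_card => w; rewrite !inE.
- by rewrite !IH -big_split mulr_suml.
- rewrite (sum_split (fun w => p w x) _ (fun y w => perm_run (c y) (p w) (E w))).
  by apply: eq_bigr => y _; rewrite IH; apply: eq_bigl => w; rewrite compat_f.
- rewrite (sum_split (fun w => (p w)^-1%g y) _ (fun x w => perm_run (c x) (p w) (E w))).
  by apply: eq_bigr => x _; rewrite IH; apply: eq_bigl => w; rewrite compat_finv.
- rewrite (sum_split (fun w => E w d W) _ (fun C w => perm_run (c C) (p w) (E w))).
  by apply: eq_bigr => C _; rewrite IH; apply: eq_bigl => w; rewrite compat_e.
- rewrite (sum_split (fun w => (E w d)^-1%g C) _ (fun W w => perm_run (c W) (p w) (E w))).
  by apply: eq_bigr => W _; rewrite IH; apply: eq_bigl => w; rewrite compat_einv.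
Qed.

Lemma ncompatE F Q : ncompat F Q = \sum_(w | compat F Q w) 1.
Proof.
by rewrite sumr_const; congr (_ *+ _); apply: eq_card => w; rewrite !inE.
Qed.

Lemma ncompat_f F Q x : \sum_y ncompat ((x, y) :: F) Q = ncompat F Q.
Proof.
rewrite [RHS]ncompatE (sum_split (fun w => p w x) _ (fun _ _ => 1)).
by apply: eq_bigr => y _; rewrite ncompatE; apply: eq_bigl => w; rewrite compat_f.
Qed.

Lemma ncompat_finv F Q y : \sum_x ncompat ((x, y) :: F) Q = ncompat F Q.
Proof.
rewrite [RHS]ncompatE (sum_split (fun w => (p w)^-1%g y) _ (fun _ _ => 1)).
by apply: eq_bigr => x _; rewrite ncompatE; apply: eq_bigl => w; rewrite compat_finv.
Qed.

Lemma ncompat_e F Q d W : \sum_C ncompat F ((d, W, C) :: Q) = ncompat F Q.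
Proof.
rewrite [RHS]ncompatE (sum_split (fun w => E w d W) _ (fun _ _ => 1)).
by apply: eq_bigr => C _; rewrite ncompatE; apply: eq_bigl => w; rewrite compat_e.
Qed.

Lemma ncompat_einv F Q d C : \sum_W ncompat F ((d, W, C) :: Q) = ncompat F Q.
Proof.
rewrite [RHS]ncompatE (sum_split (fun w => (E w d)^-1%g C) _ (fun _ _ => 1)).
by apply: eq_bigr => W _; rewrite ncompatE; apply: eq_bigl => w; rewrite compat_einv.
Qed.

(* Sequential union bound, c being the cost of one related-key query. *)
Lemma tsum_bad (me : nat) (bad : E_log -> bool) (c : R) D F Q qf r :
  0 <= c ->
  (forall F Q d W, (size Q < me)%N ->
     \sum_C ncompat F ((d, W, C) :: Q) * (bad ((d, W, C) :: Q))%:R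
       <= ncompat F Q * ((bad Q)%:R + c)) ->
  (forall F Q d C, (size Q < me)%N ->
     \sum_W ncompat F ((d, W, C) :: Q) * (bad ((d, W, C) :: Q))%:R
       <= ncompat F Q * ((bad Q)%:R + c)) ->
  queries_ok D qf r -> (size Q + r <= me)%N ->
  tsum (fun F Q b => ncompat F Q * (bad Q)%:R) D F Q <= ncompat F Q * ((bad Q)%:R + r%:R * c).
Proof.
move=> c0 stepE stepI.
elim: D F Q qf r => [b|k IH|x k IH|y k IH|d W k IH|d C k IH] F Q qf r /=.
- by move=> _ _; rewrite ler_wpM2l ?ler0n // lerDl mulr_ge0 ?ler0n.
- move=> ok sQ; rewrite ler_pdivrMr ?ltr0n // mulr_natr mulr2n.
  by rewrite lerD // (IH _ _ _ qf).
- move=> [_ ok] sQ; rewrite -(ncompat_f F Q x) mulr_suml; apply: ler_sum => y _.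
  by apply: (IH _ _ _ qf.-1).
- move=> [_ ok] sQ; rewrite -(ncompat_finv F Q y) mulr_suml; apply: ler_sum => x _.
  by apply: (IH _ _ _ qf.-1).
- case: r => [|r] [] // _ ok sQ.
  (* Induction charges the [r] later queries; [stepE] then charges the present one. *)
  apply: (@le_trans _ _ (\sum_C ncompat F ((d, W, C) :: Q) *
      ((bad ((d, W, C) :: Q))%:R + r%:R * c))).
    by apply: ler_sum => C _; apply: (IH _ _ _ qf) => //=; rewrite addSnnS.
  under eq_bigr do rewrite mulrDr.
  rewrite big_split -mulr_suml ncompat_e.
  apply: le_trans (lerD (stepE _ _ _ _ _) (lexx _)) _; first lia.
  by rewrite -natr1 -mulrDr mulrDl mul1r addrA addrAC.
- case: r => [|r] [] // _ ok sQ.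
  apply: (@le_trans _ _ (\sum_W ncompat F ((d, W, C) :: Q) *
      ((bad ((d, W, C) :: Q))%:R + r%:R * c))).
    by apply: ler_sum => W _; apply: (IH _ _ _ qf) => //=; rewrite addSnnS.
  under eq_bigr do rewrite mulrDr.
  rewrite big_split -mulr_suml ncompat_einv.
  apply: le_trans (lerD (stepI _ _ _ _ _) (lexx _)) _; first lia.
  by rewrite -natr1 -mulrDr mulrDl mul1r addrA addrAC.
Qed.

Lemma tsum_ncompat D F Q : tsum (fun F Q _ => ncompat F Q) D F Q = ncompat F Q.
Proof.
elim: D F Q => [b|c IH|x c IH|y c IH|d W c IH|d C c IH] F Q //=.
- by rewrite !IH; lra.
- by rewrite -[RHS](ncompat_f F Q x); apply: eq_bigr.
- by rewrite -[RHS](ncompat_finv F Q y); apply: eq_bigr.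
- by rewrite -[RHS](ncompat_e F Q d W); apply: eq_bigr.
- by rewrite -[RHS](ncompat_einv F Q d C); apply: eq_bigr.
Qed.

End Worlds.
End TranscriptSums.

(** * Failures over all blocks *)

Section PairFails.
Variables (R : realFieldType) (T : finType).

(** A failure fixes the first coordinate, and the second takes at most [#|T|] values. *)
Lemma nfail_fst (g : pred (T * T)) c :
  (forall C, C.1 != c -> g C) -> nfail R [set: T * T] g <= #|T|%:R.
Proof.
move=> gc; rewrite ler_nat -(card_in_imset (f := snd)) ?max_card //.
move=> [x y] [x' y']; rewrite !inE /= => gx gx' ->.
have /eqP-> : x == c by apply: contraNT gx => /(gc (x, y)).
by have /eqP-> : x' == c by apply: contraNT gx' => /(gc (x', y')).
Qed.

Lemma nfail_snd (g : pred (T * T)) c :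
  (forall C, C.2 != c -> g C) -> nfail R [set: T * T] g <= #|T|%:R.
Proof.
move=> gc; rewrite ler_nat -(card_in_imset (f := fst)) ?max_card //.
move=> [x y] [x' y']; rewrite !inE /= => gx gx' ->.
have /eqP-> : y == c by apply: contraNT gx => /(gc (x, y)).
by have /eqP-> : y' == c by apply: contraNT gx' => /(gc (x', y')).
Qed.

Lemma nfail_pt (g : pred (T * T)) c :
  (forall C, C != c -> g C) -> nfail R [set: T * T] g <= 1.
Proof.
move=> gc; rewrite -[leRHS]/(1%:R) ler_nat -(cards1 c) subset_leq_card //.
by apply/subsetP => C; rewrite !inE /=; apply: contraNT => /gc.
Qed.

End PairFails.

(** * Good transcripts of the 4-round cipher *)

Section Cipher.
Variables (R : realFieldType) (n : nat) (w0 w1 w2 w3 : B n -> B n) (g : 'I_4 -> B n -> B n).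
Notation V := (B n).
Notation entry := (V * (V * V) * (V * V))%type.
Implicit Types (k d : V) (e : entry) (F : seq (V * V)) (Q : seq entry) (P : {perm V}).

Lemma addvv (x : V) : x + x = 0.
Proof. by apply/rowP => i; rewrite !mxE; apply: addrr_pchar2; rewrite pchar_Fp. Qed.

Lemma addKv (x y : V) : x + (x + y) = y.
Proof. by rewrite addrA addvv add0r. Qed.

Lemma oppv (x : V) : - x = x.
Proof. by apply/eqP; rewrite eq_sym -addr_eq0 addvv. Qed.

Lemma KAFwK (t : nat) (f : V -> V) (h : 'I_t -> V -> V) k :
  cancel (KAFw f w0 w1 w2 w3 h k) (KAFw_inv f w0 w1 w2 w3 h k).
Proof.
move=> W; rewrite /KAFw /KAFw_inv /= !addKv -surjective_pairing foldl_rev.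
suff -> X s : foldr (fun i Y => Psi_inv f (h i k) Y)
    (foldl (fun Y i => Psi f (h i k) Y) X s) s = X by rewrite /= !addKv -surjective_pairing.
elim: s X => //= i s IHs X; rewrite IHs /Psi_inv /Psi /=.
by rewrite -addrA addvv addr0 -surjective_pairing.
Qed.

Definition kaf_perm P k : {perm V * V} := perm (can_inj (KAFwK P g k)).

Lemma kaf_permE P k W : kaf_perm P k W = KAFw P w0 w1 w2 w3 g k W.
Proof. exact: permE. Qed.

Lemma kaf_permVE P k C : (kaf_perm P k)^-1%g C = KAFw_inv P w0 w1 w2 w3 g k C.
Proof. by rewrite -{2}(permKV (kaf_perm P k) C) kaf_permE KAFwK. Qed.

Let g2 := g (Ordinal (isT : (1 < 4)%N)).
Let g3 := g (Ordinal (isT : (2 < 4)%N)).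

(* For an entry e = (Delta, (L, R), (S, T)) of the transcript: u1 and u4 are the inputs
   of P in rounds 1 and 4; with X = P (u1 k e), Y = P (u4 k e), rounds 2 and 3 are
   consistent with e as soon as P maps a2 k e + X to b2 k e + Y and a3 k e + Y to
   b3 k e + X. *)
Definition u1 k e := g ord0 (k + e.1.1) + (w1 (k + e.1.1) + e.1.2.2).
Definition u4 k e := g ord_max (k + e.1.1) + (w2 (k + e.1.1) + e.2.1).
Definition a2 k e := g2 (k + e.1.1) + (w0 (k + e.1.1) + e.1.2.1).
Definition b2 k e := w1 (k + e.1.1) + e.1.2.2 + (w3 (k + e.1.1) + e.2.2).
Definition a3 k e := g3 (k + e.1.1) + (w3 (k + e.1.1) + e.2.2).
Definition b3 k e := w0 (k + e.1.1) + e.1.2.1 + (w2 (k + e.1.1) + e.2.1).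

(** The state after round 1 has right half [w0 + L + X]. The first equation turns the right half
    after round 2 into [w3 + T + Y], the second turns the one after round 3 into [w2 + S]; round 4
    then cancels [Y], and whitening leaves [(S, T)]. *)
Lemma kaf_perm_middle P k e :
  P (a2 k e + P (u1 k e)) = b2 k e + P (u4 k e) ->
  P (a3 k e + P (u4 k e)) = b3 k e + P (u1 k e) ->
  kaf_perm P (k + e.1.1) e.1.2 = e.2.
Proof.
case: e => [[d [L0 R0]] [S0 T0]]; rewrite kaf_permE /u1 /u4 /a2 /a3 /b2 /b3 /KAFw /=.
have -> : enum 'I_4 = [:: ord0; Ordinal (isT : (1 < 4)%N); Ordinal (isT : (2 < 4)%N); ord_max].
  by apply: (inj_map val_inj); rewrite val_enum_ord.
rewrite /= /Psi /= -/g2 -/g3; move: (k + d) => K.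
have cancel2 (x y z : V) : x + (y + (x + (y + z))) = z by rewrite addrCA addKv addKv.
have cancel3 (x y p z t : V) : x + (y + (p + (x + (y + (z + (t + p)))))) = z + t.
  by rewrite (addrCA p) (addrCA p) cancel2 addrC -!addrA addvv addr0.
have [p1 p1E] : {p | p = P (g ord0 K + (w1 K + R0))} by eexists.
have [p4 p4E] : {p | p = P (g ord_max K + (w2 K + S0))} by eexists.
rewrite -!addrA -p1E -p4E => r2 r3; rewrite r2 cancel2 r3 (cancel3 (w0 K) L0 p1) -p4E.
by rewrite addKv -!addrA (cancel2 (w1 K) R0) addvv addr0 addKv.
Qed.

(** Entries with equal offsets are exempt from the second test: whether their outer inputs collide
    does not depend on the key, and [goodB] handles them. *)
Definition goodA k F Q :=
  [&& allrel (fun e f => (u1 k e != f.1) && (u4 k e != f.1)) Q F,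
      pairwise (fun e e' => (e.1.1 == e'.1.1) || (u1 k e != u1 k e') && (u4 k e != u4 k e')) Q
    & allrel (fun e e' => u1 k e != u4 k e') Q Q].

(** For equal offsets the key masks cancel: [u1] collides when [R = R'], and then [b3] collides when
    [L + S = L' + S']; [u4] collides when [S = S'], and then [b2] when [R + T = R' + T']. *)
Definition pair_ok e e' :=
  [|| e == e', e.1.1 != e'.1.1 |
      ((e.1.2.2 != e'.1.2.2) || (e.1.2.1 + e.2.1 != e'.1.2.1 + e'.2.1)) &&
      ((e.2.1 != e'.2.1) || (e.1.2.2 + e.2.2 != e'.1.2.2 + e'.2.2))].

Definition single_ok k e := (b2 k e != 0) && (b3 k e != 0).

Definition goodB k Q := all (single_ok k) Q && pairwise pair_ok Q.

Lemma pair_ok_refl : reflexive pair_ok.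
Proof. by move=> e; rewrite /pair_ok eqxx. Qed.

Lemma pair_ok_sym : symmetric pair_ok.
Proof.
by move=> e e'; rewrite /pair_ok eq_sym; congr [|| _, ~~ _ | (~~ _ || ~~ _) && (~~ _ || ~~ _)];
  rewrite eq_sym.
Qed.

(** Repeated queries therefore cost nothing in [bad_step]. *)
Lemma goodB_mem k e Q : e \in Q -> goodB k (e :: Q) = goodB k Q.
Proof.
move=> eQ; rewrite /goodB /=; apply/idP/idP => [/and3P[/andP[_ ->] _ ->] //|].
case/andP=> sQ; have := sQ => /allP/(_ _ eQ) ->; rewrite sQ /= => pQ; rewrite pQ andbT.
move: pQ; rewrite (pairwise_all2rel pair_ok_refl pair_ok_sym) => /allrelP pQ.
by apply/allP => e' e'Q; apply: pQ.
Qed.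

(** In characteristic 2 each collision is an equation on [phi1] or [phi4] at shifted keys, as
    bounded by [good_ks]: [2 * d1] per entry and query to [P], [2 * d2] per unordered pair of
    entries, [d3] per ordered pair. *)
Lemma nfail_goodA (d1 d2 d3 : R) (qf qe : nat) F Q :
  (0 < n)%N -> good_ks w1 w2 g d1 d2 d3 -> (size F <= qf)%N -> (size Q <= qe)%N ->
  nfail R [set: V] (fun k => goodA k F Q) <=
    #|{: V}|%:R * (2 * d1 * qe%:R * qf%:R + (d2 + d3) * qe%:R ^+ 2).
Proof.
move=> n_gt0 [ks12 ks3] szF szQ; set N : R := _%:R.
have N_gt0 : 0 < N by rewrite ltr0n; apply/card_gt0P; exists 0.
have prkE (p gd : pred V) c : prk R p <= c -> (forall k, ~~ p k -> gd k) ->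
    nfail R [set: V] gd <= N * c.
  rewrite /prk -/N ler_pdivrMr // mulrC => le_c pg; apply: le_trans le_c.
  rewrite ler_nat; apply: subset_leq_card; apply/subsetP => k; rewrite !inE /=.
  by apply: contraNT => /pg.
have [/(_ _ (or_introl erefl))[p1 q1] /(_ _ (or_intror erefl))[p4 q4]] := (ks12, ks12).
have uE (x y z t : V) : x + (y + z) = t -> y + x = t + z.
  by move=> <-; rewrite -!addrA addvv addr0 addrC.
(* The bound by [d2] needs two distinct offsets; since [n > 0], zero and the all-ones vector will
   do. *)
have d2_ge0 : 0 <= d2.
  apply: le_trans (q1 0 (const_mx 1) 0 _); first by rewrite divr_ge0 ?ler0n.
  apply/eqP => /rowP/(_ (Ordinal n_gt0)); rewrite !mxE => /eqP.
  by rewrite eq_sym oner_eq0.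
have pt e (f : V * V) : nfail R [set: V] (fun k => (u1 k e != f.1) && (u4 k e != f.1))
    <= N * (d1 + d1).
  rewrite mulrDr; apply: nfail_and_le.
    by apply: prkE (p1 e.1.1 (f.1 + e.1.2.2)) _ => k; apply: contra => /eqP/uE/eqP.
  by apply: prkE (p4 e.1.1 (f.1 + e.2.1)) _ => k; apply: contra => /eqP/uE/eqP.
have uE2 (x y z x' y' z' : V) : x + (y + z) = x' + (y' + z') -> y + x + (y' + x') = z + z'.
  move=> eq; rewrite -[RHS]oppv; apply/eqP; rewrite -addr_eq0; apply/eqP.
  by rewrite addrACA [y + x]addrC [y' + x']addrC -(addrA x) -(addrA x') eq addvv.
have pr e e' : nfail R [set: V] (fun k => (e.1.1 == e'.1.1) ||
    (u1 k e != u1 k e') && (u4 k e != u4 k e')) <= N * (d2 + d2).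
  have [_|neq] := eqVneq e.1.1 e'.1.1.
    by rewrite nfail_true // mulr_ge0 ?addr_ge0 // ltW.
  rewrite /= mulrDr; apply: nfail_and_le.
    apply: prkE (q1 _ _ (e.1.2.2 + e'.1.2.2) neq) _ => k.
    by apply: contra => /eqP/uE2/eqP.
  apply: prkE (q4 _ _ (e.2.1 + e'.2.1) neq) _ => k.
  by apply: contra => /eqP/uE2/eqP.
have cr e e' : nfail R [set: V] (fun k => u1 k e != u4 k e') <= N * d3.
  apply: prkE (ks3 e.1.1 e'.1.1 (e.1.2.2 + e'.2.1)) _ => k.
  by apply: contra => /eqP/uE2/eqP.
apply: le_trans (nfail_and_le (nfail_allrel (fun e f _ _ => pt e f))
  (nfail_and_le (nfail_pairwise _ (fun e e' _ _ => pr e e'))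
     (nfail_allrel (fun e e' _ _ => cr e e')))) _.
  by rewrite mulr_ge0 ?addr_ge0 // ltW.
(* Nonnegativity of the parameters allows replacing the log sizes by the budgets. *)
have d1_ge0 : 0 <= d1 by apply: le_trans (p1 0 0); rewrite divr_ge0 ?ler0n.
have d3_ge0 : 0 <= d3 by apply: le_trans (ks3 0 0 0); rewrite divr_ge0 ?ler0n.
have leF : (size F)%:R <= qf%:R :> R by rewrite ler_nat.
have leQ : (size Q)%:R <= qe%:R :> R by rewrite ler_nat.
apply: (@le_trans _ _ (N * (2 * d1 * ((size Q)%:R * (size F)%:R) +
    (d2 + d3) * (size Q)%:R ^+ 2))).
  by rewrite le_eqVlt; apply/orP; left; apply/eqP; field.
rewrite -(mulrA (2 * d1)) ler_wpM2l ?lerD ?ler_wpM2l ?mulr_ge0 ?addr_ge0 ?(ltW N_gt0) //.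
  by rewrite ler_pM.
by rewrite lerXn2r ?nnegrE.
Qed.

Notation family := {ffun V -> {perm V * V}}.

Lemma ratio_loss_le (q q' m m' : nat) : (q <= q')%N -> (m <= m')%N ->
  (8 * q%:R * m%:R + 24 * q%:R ^+ 2) / #|{: V}|%:R
    <= (8 * q'%:R * m'%:R + 24 * q'%:R ^+ 2) / #|{: V}|%:R :> R.
Proof.
move=> qq mm; rewrite ler_wpM2r ?invr_ge0 ?ler0n // -!natrX -!mulrA -!natrM -!natrD ler_nat.
by rewrite leq_add // leq_mul // ?leq_mul // leq_exp2r.
Qed.

(** [card_extends_middle] bounds the real count below and [card_fam_extends] the ideal one above;
    both apply to the logs without repetitions. *)
Lemma good_ratio (qf qe : nat) k F Q :
  (2 * (qf + 2 * qe) <= #|{: V}|)%N -> (size F <= qf)%N -> (size Q <= qe)%N ->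
  goodA k F Q -> goodB k Q ->
  (1 - (8 * qe%:R * qf%:R + 24 * qe%:R ^+ 2) / #|{: V}|%:R) *
    (#|[set P | extends P F]| * #|[set E : family | fam_extends E Q]|)%:R
  <= (#|[set P | extends P F && fam_extends (fun d => kaf_perm P (k + d)) Q]|
      * #|{: family}|)%:R :> R.
Proof.
move=> sizes szF szQ /and3P[/allrelP aF aQ /allrelP a14] /andP[/allP sQ pQ].
(* Without a family extending [Q] the ideal count is 0. Otherwise [E0] shows that [Q] is consistent
   with permutations, which separates [a2] and [a3] below. *)
have [E0 /= E0Q|none] := pickP [pred E : family | fam_extends E Q]; last first.
  rewrite (_ : [set E : family | _] = set0) ?cards0 ?muln0 ?mulr0 ?ler0n //.
  by apply/setP => E; rewrite !inE; exact: none.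
move: aQ; rewrite pairwise_all2rel => [/allrelP aQ|e|e e']; last first.
- by rewrite eq_sym (eq_sym (u1 k e)) (eq_sym (u4 k e)).
- by rewrite eqxx.
move: pQ; rewrite (pairwise_all2rel pair_ok_refl pair_ok_sym) => /allrelP pQ.
have sameD e e' : e \in Q -> e' \in Q -> (u1 k e = u1 k e') \/ (u4 k e = u4 k e') ->
    e.1.1 = e'.1.1.
  by move=> eQ e'Q; have := aQ _ _ eQ e'Q; case: eqP => //= _ /andP[/eqP ? /eqP ?] [].
have uF := undup_uniq F; have uQ := undup_uniq Q.
have ext_undup P : extends P (undup F) = extends P F by exact: all_undup.
have szF' : (size (undup F) <= qf)%N := leq_trans (size_undup F) szF.
have szQ' : (size (undup Q) <= qe)%N := leq_trans (size_undup Q) szQ.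
have sizes' : (2 * (size (undup F) + 2 * size (undup Q)) <= #|{: V}|)%N.
  by apply: leq_trans sizes; rewrite leq_mul2l leq_add // leq_mul2l.
have pt (v : entry -> V) : (forall e f, e \in Q -> f \in F -> v e != f.1) ->
    {in undup Q, forall e, v e \notin unzip1 (undup F)}.
  move=> vF e; rewrite mem_undup => eQ; apply/negP => /mapP[f].
  by rewrite mem_undup => fF eq; have := vF e f eQ fF; rewrite eq eqxx.
have hu1 := pt _ (fun e f eQ fF => proj1 (andP (aF e f eQ fF))).
have hu4 := pt _ (fun e f eQ fF => proj2 (andP (aF e f eQ fF))).
have hu14 : {in undup Q &, forall e e', u1 k e != u4 k e'}.
  by move=> e e'; rewrite !mem_undup; exact: a14.
have hu1_eq : {in undup Q &, forall e e', e != e' -> u1 k e = u1 k e' ->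
    (a2 k e != a2 k e') && (b3 k e != b3 k e')}.
  move=> e e'; rewrite !mem_undup => eQ e'Q neq equ.
  have eqd := sameD _ _ eQ e'Q (or_introl equ).
  have := pQ _ _ eQ e'Q; rewrite /pair_ok (negPf neq) eqd eqxx /= => /andP[pL _].
  have eqR : e.1.2.2 = e'.1.2.2 by move: equ; rewrite /u1 eqd => /addrI/addrI.
  apply/andP; split; last first.
    apply: contraTneq pL; rewrite /b3 eqd addrACA [RHS]addrACA => /addrI ->.
    by rewrite eqR !eqxx.
  (* Equal [a2] would give equal plaintexts under one offset, hence the same answer of [E0] and the
     same entry. *)
  apply: contra_neq neq; rewrite /a2 eqd => /addrI/addrI eqL.
  have eq1 : e.1 = e'.1 by case: (e) eqd eqR eqL => -[? [? ?]] ? /= -> -> ->; case: (e') => -[? []].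
  have /fam_extendsP EQ := E0Q.
  by rewrite (surjective_pairing e) (surjective_pairing e') -(EQ _ eQ) -(EQ _ e'Q) eq1.
have hu4_eq : {in undup Q &, forall e e', e != e' -> u4 k e = u4 k e' ->
    (b2 k e != b2 k e') && (a3 k e != a3 k e')}.
  move=> e e'; rewrite !mem_undup => eQ e'Q neq equ.
  have eqd := sameD _ _ eQ e'Q (or_intror equ).
  have := pQ _ _ eQ e'Q; rewrite /pair_ok (negPf neq) eqd eqxx /= => /andP[_ pR].
  have eqS : e.2.1 = e'.2.1 by move: equ; rewrite /u4 eqd => /addrI/addrI.
  apply/andP; split.
    apply: contraTneq pR; rewrite /b2 eqd addrACA [RHS]addrACA => /addrI ->.
    by rewrite eqS !eqxx.
  (* Equal [a3] would give equal ciphertexts, hence equal plaintexts by injectivity of [E0]. *)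
  apply: contra_neq neq; rewrite /a3 eqd => /addrI/addrI eqT.
  have eq2 : e.2 = e'.2 by rewrite (surjective_pairing e.2) eqS eqT -surjective_pairing.
  have /fam_extendsP EQ := E0Q.
  have eq12 : e.1.2 = e'.1.2.
    by apply: (@perm_inj _ (E0 e.1.1)); rewrite EQ // {1}eqd EQ.
  by case: (e) (e') eqd eq12 eq2 => -[? ?] ? [[? ?] ?] /= -> -> ->.
have hb : {in undup Q, forall e, (b2 k e != 0) && (b3 k e != 0)}.
  by move=> e; rewrite mem_undup; exact: sQ.
have := card_extends_middle R uF uQ sizes' hu1 hu4 hu14 hu1_eq hu4_eq hb.
have -> : [set P | extends P (undup F)] = [set P | extends P F].
  by apply/setP => P; rewrite !inE ext_undup.
set X := #|[set P | _ && _]|; set ff := (_ ^_ _)%N => mid.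
have leX : (X <= #|[set P | extends P F && fam_extends (fun d => kaf_perm P (k + d)) Q]|)%N.
  apply: subset_leq_card; apply/subsetP => P; rewrite !inE ext_undup.
  rewrite /middle extends_cat => /and3P[-> m1 m2] /=; apply/fam_extendsP => e eQ.
  apply: kaf_perm_middle; apply/eqP.
    by have /allP/(_ _ (map_f _ (_ : e \in undup Q)))/= := m1; apply; rewrite mem_undup.
  by have /allP/(_ _ (map_f _ (_ : e \in undup Q)))/= := m2; apply; rewrite mem_undup.
have leE : (#|[set E : family | fam_extends E Q]| * ff <= #|{: family}|)%N.
  have := @card_fam_extends V (V * V)%type (undup Q) uQ; rewrite card_prod mulnn.
  apply: leq_trans; rewrite leq_mul2r; apply/orP; right.
  by apply: subset_leq_card; apply/subsetP => E; rewrite !inE /fam_extends all_undup.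
rewrite natrM mulrA; set c := #|[set E : family | _]| in leE *.
apply: (@le_trans _ _ ((X * ff)%:R * c%:R)).
  rewrite ler_wpM2r ?ler0n //; apply: le_trans mid; rewrite ler_wpM2r ?ler0n //.
  by rewrite lerD2l lerN2 ratio_loss_le.
by rewrite -natrM ler_nat -mulnA leq_mul // mulnC.
Qed.

(** * Bad transcripts in the ideal world *)

Let ideal_P (w : {perm V} * family) := w.1.
(** The family is indexed by the offset rather than by [k + d]; [P_idealE] removes the key by a
    translation. *)
Let ideal_E (w : {perm V} * family) d := w.2 d.
Let ideal := ncompat R ideal_P ideal_E.

Lemma idealE F Q :
  ideal F Q = (#|[set P | extends P F]| * #|[set E : family | fam_extends E Q]|)%:R.
Proof.
rewrite -cardsX; congr _%:R; apply: eq_card => -[P E]; rewrite !inE.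
by rewrite /compat /ideal_P /ideal_E /=.
Qed.

(** With [s < qe] earlier entries, at most [2 N + s (N + 1)] answers are bad, each with probability
    at most [1 / (N^2 - s)]. Over [qe] queries this costs [(3 qe^2 + 4 qe) / N]. *)
Definition step_cost (qe : nat) : R := (3 * qe%:R + 4) / #|{: V}|%:R.

(** [mk] completes the query by its answer, so both query directions are covered. *)
Lemma bad_step (qe : nat) k F Q (mk : V * V -> entry) :
  (4 * qe <= #|{: V}|)%N -> (size Q < qe)%N ->
  \sum_v ideal F (mk v :: Q) = ideal F Q ->
  nfail R [set: V * V] (fun v => single_ok k (mk v)) <= #|{: V}|%:R + #|{: V}|%:R ->
  (forall e, nfail R [set: V * V] (fun v => pair_ok (mk v) e) <= #|{: V}|%:R + 1) ->
  \sum_v ideal F (mk v :: Q) * (~~ goodB k (mk v :: Q))%:R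
    <= ideal F Q * ((~~ goodB k Q)%:R + step_cost qe).
Proof.
move=> le_qe ltQ sum_ideal single pair; set N := #|{: V}| in le_qe single pair *.
have N_gt0 : (0 < N)%N by apply/card_gt0P; exists 0.
pose ok v := single_ok k (mk v) && all (pair_ok (mk v)) Q.
have N2 : (size Q < N ^ 2)%N by nia.
have D_gt0 : 0 < (N ^ 2 - size Q)%:R :> R by rewrite ltr0n subn_gt0.
have ideal_ge0 F' Q' : 0 <= ideal F' Q' by exact: ler0n.
(* A repeated entry keeps [goodB] unchanged; a new one is compatible with at most a fraction
   [1 / (N^2 - size Q)] of the worlds. *)
have term v : ideal F (mk v :: Q) * (~~ goodB k (mk v :: Q))%:R
    <= ideal F (mk v :: Q) * (~~ goodB k Q)%:R
       + ideal F Q / (N ^ 2 - size Q)%:R * (~~ ok v)%:R.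
  case: (boolP (mk v \in Q)) => vQ.
    by rewrite goodB_mem // lerDl mulr_ge0 ?divr_ge0 ?ler0n.
  have le1 : ideal F (mk v :: Q) <= ideal F Q / (N ^ 2 - size Q)%:R.
    rewrite ler_pdivlMr // !idealE -natrM ler_nat -mulnA leq_mul2l.
    have := card_fam_extends_fresh vQ; rewrite card_prod mulnn -/N => ->.
    by rewrite orbT.
  apply: (@le_trans _ _ (ideal F (mk v :: Q) * ((~~ goodB k Q)%:R + (~~ ok v)%:R))).
    rewrite ler_wpM2l // -natrD ler_nat /goodB /ok /=.
    by case: single_ok; case: (all (single_ok k) Q); case: (pairwise _ _); case: (all _ _).
  by rewrite mulrDr lerD2l ler_wpM2r ?ler0n.
apply: le_trans (ler_sum _ (fun v _ => term v)) _.
rewrite big_split -mulr_suml sum_ideal mulrDr lerD2l -mulr_sumr -mulrA ler_wpM2l //.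
have -> : \sum_v (~~ ok v)%:R = nfail R [set: V * V] ok.
  rewrite /nfail -sum1_card natr_sum (bigID (fun v => ~~ ok v)) /= addrC big1 ?add0r.
    by apply: eq_big => [v|v ->]; rewrite ?inE.
  by move=> v /negPn ->.
have okb : nfail R [set: V * V] ok <= N%:R + N%:R + (size Q)%:R * (N%:R + 1).
  by apply: nfail_and_le single _; apply: nfail_all => e _; exact: pair.
rewrite mulrC ler_pdivrMr //; apply: le_trans okb _.
rewrite /step_cost -/N mulrAC ler_pdivlMr ?ltr0n //.
rewrite natrB ?natrX; last exact: ltnW.
(* It remains to see [(2 N + s (N + 1)) N <= (3 q + 4) (N^2 - s)] for [s <= q - 1] and
   [4 q <= N]. *)
have : (size Q)%:R <= qe%:R - 1 :> R by rewrite lerBrDr natr1 ler_nat.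
have : 4 * qe%:R <= N%:R :> R by rewrite -natrM ler_nat.
have : 0 <= (size Q)%:R :> R by exact: ler0n.
move: (size Q)%:R qe%:R N%:R => s q M s0 qM sq.
nra.
Qed.

Lemma nfail_single_e k d W :
  nfail R [set: V * V] (fun C => single_ok k (d, W, C)) <= #|{: V}|%:R + #|{: V}|%:R.
Proof.
have solve (A B x : V) : A + (B + x) = 0 -> x = B + A.
  by move=> eq; rewrite -[x](addKv B) -[B + x](addKv A) eq addr0.
apply: nfail_and_le.
  apply: (@nfail_snd _ _ _ (w3 (k + d) + (w1 (k + d) + W.2))) => C.
  by apply: contraNneq => /solve ->.
apply: (@nfail_fst _ _ _ (w2 (k + d) + (w0 (k + d) + W.1))) => C.
by apply: contraNneq => /solve ->.
Qed.

Lemma nfail_single_einv k d C :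
  nfail R [set: V * V] (fun W => single_ok k (d, W, C)) <= #|{: V}|%:R + #|{: V}|%:R.
Proof.
have solve (A B x : V) : A + x + B = 0 -> x = A + B.
  by move=> eq; rewrite -[LHS](addKv A) -[A + x](addrK B) eq oppv add0r.
apply: nfail_and_le.
  apply: (@nfail_snd _ _ _ (w1 (k + d) + (w3 (k + d) + C.2))) => W.
  by apply: contraNneq => /solve ->.
apply: (@nfail_fst _ _ _ (w0 (k + d) + (w2 (k + d) + C.1))) => W.
by apply: contraNneq => /solve ->.
Qed.

(** Failure of the first clause fixes [S], leaving [N] ciphertexts; failure of the second fixes both
    [S] and [T]. For inverse queries the two clauses swap roles. *)
Lemma nfail_pair_e d W e :
  nfail R [set: V * V] (fun C => pair_ok (d, W, C) e) <= #|{: V}|%:R + 1.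
Proof.
have solve (A B x : V) : A + x = B -> x = A + B by move=> <-; rewrite addKv.
apply: le_trans (nfail_le _ (g' := fun C =>
    ((W.2 != e.1.2.2) || (W.1 + C.1 != e.1.2.1 + e.2.1)) &&
    ((C.1 != e.2.1) || (W.2 + C.2 != e.1.2.2 + e.2.2))) _) _.
  by rewrite /pair_ok => C _ ->; rewrite !orbT.
apply: nfail_and_le.
  apply: (@nfail_fst _ _ _ (W.1 + (e.1.2.1 + e.2.1))) => C /= neq; apply/orP; right.
  by apply: contraNneq neq => /solve ->.
apply: (@nfail_pt _ _ _ (e.2.1, W.2 + (e.1.2.2 + e.2.2))) => C /=.
by apply: contraNT; case: C => S T /=; rewrite negb_or !negbK => /andP[/eqP -> /eqP/solve ->].
Qed.

Lemma nfail_pair_einv d C e :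
  nfail R [set: V * V] (fun W => pair_ok (d, W, C) e) <= #|{: V}|%:R + 1.
Proof.
have solve (A B x : V) : x + A = B -> x = B + A by move=> <-; rewrite -addrA addvv addr0.
apply: le_trans (nfail_le _ (g' := fun W =>
    ((W.2 != e.1.2.2) || (W.1 + C.1 != e.1.2.1 + e.2.1)) &&
    ((C.1 != e.2.1) || (W.2 + C.2 != e.1.2.2 + e.2.2))) _) _.
  by rewrite /pair_ok => W _ ->; rewrite !orbT.
rewrite [leRHS]addrC; apply: nfail_and_le.
  apply: (@nfail_pt _ _ _ (e.1.2.1 + e.2.1 + C.1, e.1.2.2)) => W /=.
  by apply: contraNT; case: W => L0 R0 /=; rewrite negb_or !negbK => /andP[/eqP -> /eqP/solve ->].
apply: (@nfail_snd _ _ _ (e.1.2.2 + e.2.2 + C.2)) => W /= neq; apply/orP; right.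
by apply: contraNneq neq => /solve ->.
Qed.

Lemma tsum_ideal_bad k D (qf qe : nat) : (4 * qe <= #|{: V}|)%N -> queries_ok D qf qe ->
  tsum (fun F Q _ => ideal F Q * (~~ goodB k Q)%:R) D [::] [::]
    <= ideal [::] [::] * (qe%:R * step_cost qe).
Proof.
move=> le_qe ok; rewrite -[qe%:R * _]add0r.
apply: (@tsum_bad _ _ _ _ _ qe (fun Q => ~~ goodB k Q) _ _ _ _ qf) => //.
- by rewrite divr_ge0 ?ler0n // addr_ge0 ?mulr_ge0 ?ler0n.
- move=> F Q d W ltQ; apply: (@bad_step qe k F Q (fun C => (d, W, C))) => //.
    exact: ncompat_e.
    exact: nfail_single_e.
  by move=> e; exact: nfail_pair_e.
- move=> F Q d C ltQ; apply: (@bad_step qe k F Q (fun W => (d, W, C))) => //.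
    exact: ncompat_einv.
    exact: nfail_single_einv.
  by move=> e; exact: nfail_pair_einv.
Qed.

(** * Comparison of the two worlds *)

Let real k := ncompat R (fun P : {perm V} => P) (fun P d => kaf_perm P (k + d)).

(** The weight [beta] of the output bit is arbitrary in [[0, 1]], so that the bit and its negation
    give the two signs of the advantage. *)
Lemma ideal_real_gap (d1 d2 d3 : R) (qf qe : nat) (beta : bool -> R) D :
  (0 < n)%N -> good_ks w1 w2 g d1 d2 d3 -> (2 * (qf + 2 * qe) <= #|{: V}|)%N ->
  queries_ok D qf qe -> (forall b, 0 <= beta b <= 1) ->
  tsum (fun F Q b => ideal F Q * beta b) D [::] [::] / (#|{: {perm V}}| * #|{: family}|)%:R
   - (\sum_k tsum (fun F Q b => real k F Q * beta b) D [::] [::])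
       / (#|{: V}| * #|{: {perm V}}|)%:R
  <= 2 * d1 * qe%:R * qf%:R + (d2 + d3) * qe%:R ^+ 2
     + (8 * qe%:R * qf%:R + 27 * qe%:R ^+ 2 + 4 * qe%:R) / #|{: V}|%:R.
Proof.
move=> n_gt0 ks sizes okD beta01.
pose N := #|{: V}|; pose K := #|{: family}|; pose M := #|{: {perm V}}|.
have N_gt0 : 0 < N%:R :> R by rewrite ltr0n; apply/card_gt0P; exists 0.
have K_gt0 : 0 < K%:R :> R by rewrite ltr0n; apply/card_gt0P; exists [ffun=> 1%g].
have M_gt0 : 0 < M%:R :> R by rewrite ltr0n; apply/card_gt0P; exists 1%g.
pose eps : R := (8 * qe%:R * qf%:R + 24 * qe%:R ^+ 2) / N%:R.
pose keys : R := 2 * d1 * qe%:R * qf%:R + (d2 + d3) * qe%:R ^+ 2.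
have eps_ge0 : 0 <= eps.
  by rewrite divr_ge0 ?ler0n // -natrX -!natrM -natrD ler0n.
have leaf F Q b : (size F <= qf)%N -> (size Q <= qe)%N ->
    N%:R * (ideal F Q * beta b) <=
    \sum_k K%:R * (real k F Q * beta b) + (N%:R * (eps + keys) * ideal F Q
      + \sum_k 1 * (ideal F Q * (~~ goodB k Q)%:R)).
  move=> szF szQ; have I_ge0 : 0 <= ideal F Q by exact: ler0n.
  have := nfail_goodA n_gt0 ks szF szQ; rewrite -/keys -/N => goodA_le.
  (* A good key loses the fraction [eps] by [good_ratio]; for a bad key the whole ideal weight is
     charged. *)
  have per_key k : ideal F Q * beta b <= K%:R * (real k F Q * beta b)
      + (ideal F Q * eps + ideal F Q * (~~ goodA k F Q)%:R
         + 1 * (ideal F Q * (~~ goodB k Q)%:R)).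
    have /andP[b0 b1] := beta01 b.
    have r_ge0 : 0 <= K%:R * real k F Q by rewrite mulr_ge0 ?ler0n.
    have := @good_ratio qf qe k F Q sizes szF szQ.
    rewrite -idealE -/eps natrM [_ * K%:R]mulrC -/(real k F Q) mulrA.
    have := mulr_ge0 I_ge0 eps_ge0; have := mulr_ge0 r_ge0 b0.
    have : 0 <= ideal F Q * (1 - beta b) by rewrite mulr_ge0 ?subr_ge0.
    move: (K%:R * _) r_ge0 => r r_ge0 i1 rb ie ratio.
    case gA: (goodA k F Q); case gB: (goodB k Q); rewrite /= ?mulr0n ?mulr1n; try lra.
    have {}ratio : (1 - eps) * ideal F Q <= r by exact: ratio.
    have := ler_wpM2r b0 ratio; have := mulr_ge0 eps_ge0 i1; lra.
  have cst (x : R) : \sum_(k : V) x = N%:R * x by rewrite sumr_const mulr_natl.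
  rewrite -cst; apply: le_trans (ler_sum _ (fun k _ => per_key k)) _.
  rewrite !big_split /= lerD2l lerD2r cst -mulr_sumr.
  have -> : \sum_k (~~ goodA k F Q)%:R = nfail R [set: V] (fun k => goodA k F Q).
    rewrite /nfail -sum1_card natr_sum (bigID (fun k => ~~ goodA k F Q)) /= addrC.
    rewrite big1 ?add0r => [|k /negPn -> //].
    by apply: eq_big => [k|k ->]; rewrite ?inE.
  have := ler_wpM2l I_ge0 goodA_le; nra.
have := tsum_le (F := [::]) (Q := [::]) leaf okD (leqnn qf) (leqnn qe).
rewrite tsumZ !tsumD tsumZ (tsum_comb (fun=> K%:R)) (tsum_comb (fun=> 1)) tsum_ncompat -/ideal.
have ideal0 : ideal [::] [::] = M%:R * K%:R.
  by rewrite idealE natrM /M /K -!cardsT; congr (_%:R * _%:R);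
    apply: eq_card => w; rewrite !inE.
(* Failures of [goodA] were averaged over the keys at each leaf; those of [goodB] are bounded for
   each key over all transcripts. *)
have bad_le : \sum_(k : V) 1 * tsum (fun F Q _ => ideal F Q * (~~ goodB k Q)%:R) D [::] [::]
    <= N%:R * (M%:R * K%:R * (qe%:R * step_cost qe)).
  have le_qe : (4 * qe <= #|{: V}|)%N by lia.
  rewrite -ideal0 mulr_natl -sumr_const; apply: ler_sum => k _.
  by rewrite mul1r; exact: tsum_ideal_bad le_qe okD.
rewrite -mulr_sumr ideal0 => tot.
have {tot bad_le} := le_trans tot (lerD (lexx _) (lerD (lexx _) bad_le)).
move: (tsum _ _ _ _) (\sum_k _) => x y tot.
rewrite !natrM -/N -/M -/K.
have -> : x / (M%:R * K%:R) - y / (N%:R * M%:R) = (N%:R * x - K%:R * y) / (N%:R * (M%:R * K%:R)).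
  by field; rewrite !lt0r_neq0.
rewrite ler_pdivrMr ?mulr_gt0 // lerBlDl; apply: le_trans tot _.
(* The coefficient 27 is 24 from [eps] plus 3 from [step_cost]. *)
rewrite lerD2l /keys /eps /step_cost -/N le_eqVlt; apply/orP; left; apply/eqP; field.
exact: lt0r_neq0.
Qed.

Lemma P_realE D :
  P_real R w0 w1 w2 w3 g D =
  (\sum_k tsum (fun F Q b => real k F Q * (b : nat)%:R) D [::] [::])
    / (#|{: V}| * #|{: {perm V}}|)%:R.
Proof.
congr (_ / _); apply: eq_bigr => k _; rewrite tsum_run; apply: eq_bigr => P _.
by apply: eq_run => // d C; rewrite ?kaf_permE ?kaf_permVE.
Qed.

Lemma P_idealE D :
  P_ideal R D = tsum (fun F Q b => ideal F Q * (b : nat)%:R) D [::] [::]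
    / (#|{: {perm V}}| * #|{: family}|)%:R.
Proof.
have N_neq0 : #|{: V}|%:R != 0 :> R.
  by rewrite pnatr_eq0 -lt0n; apply/card_gt0P; exists 0.
rewrite tsum_run /P_ideal -mulnA [in LHS]natrM invfM mulrA; congr (_ / _).
apply: (canLR (mulfK N_neq0)); rewrite mulr_natr -sumr_const; apply: eq_bigr => k _.
rewrite pair_bigA /=.
(* Translating the index by [k] permutes the families, so all keys give the same sum. *)
pose shift (E : family) : family := [ffun d => E (k + d)].
have shiftK : involutive shift by move=> E; apply/ffunP => d; rewrite !ffunE addKv.
have bij : bijective (fun w : {perm V} * family => (w.1, shift w.2)).
  by exists (fun w => (w.1, shift w.2)) => -[P E] /=; rewrite shiftK.
rewrite [RHS](reindex _ (onW_bij _ bij)) /=; apply: eq_bigr => -[P E] _.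
by apply: eq_run => // d C; rewrite /ideal_E /= ffunE.
Qed.

Lemma advantage_bound (d1 d2 d3 : R) (qf qe : nat) D :
  (0 < n)%N -> good_ks w1 w2 g d1 d2 d3 -> (2 * (qf + 2 * qe) <= #|{: V}|)%N ->
  queries_ok D qf qe ->
  `|P_real R w0 w1 w2 w3 g D - P_ideal R D|
    <= 2 * d1 * qe%:R * qf%:R + (d2 + d3) * qe%:R ^+ 2
     + (8 * qe%:R * qf%:R + 27 * qe%:R ^+ 2 + 4 * qe%:R) / #|{: V}|%:R.
Proof.
move=> n_gt0 ks sizes okD.
have gap beta := ideal_real_gap (beta := beta) n_gt0 ks sizes okD.
rewrite ler_norml; apply/andP; split.
  rewrite lerNl opprB P_realE P_idealE; apply: gap => b.
  by rewrite ler0n lern1; case: b.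
(* The other sign comes from the negated output bit; both worlds have total mass 1, which cancels in
   the difference. *)
have := gap (fun b => (~~ b : nat)%:R) (fun b => _).
have split_tsum (h : seq (V * V) -> seq entry -> R) :
    tsum (fun F Q b => h F Q * (~~ b : nat)%:R) D [::] [::] =
    tsum (fun F Q _ => h F Q) D [::] [::] - tsum (fun F Q b => h F Q * (b : nat)%:R) D [::] [::].
  rewrite -mulN1r -tsumZ -tsumD; apply: eq_tsum => F Q [] /=.
    by rewrite mulr0 mulr1 mulN1r subrr.
  by rewrite mulr0 mulr1 mulr0 addr0.
rewrite split_tsum tsum_ncompat (eq_bigr _ (fun k _ => split_tsum (real k))).
rewrite sumrB [X in _ - (X - _) / _](_ : _ = (#|{: V}| * #|{: {perm V}}|)%:R); last first.
  rewrite (eq_bigr (fun=> #|{: {perm V}}|%:R)) => [|k _].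
    by rewrite sumr_const natrM mulr_natl.
  rewrite tsum_ncompat; congr _%:R; rewrite -cardsT; apply: eq_card => P.
  by rewrite !inE.
rewrite -/ideal idealE.
have -> : #|[set P : {perm V} | extends P [::]]| = #|{: {perm V}}|.
  by rewrite -cardsT; apply: eq_card => P; rewrite !inE.
have -> : #|[set E : family | fam_extends E [::]]| = #|{: family}|.
  by rewrite -cardsT; apply: eq_card => E; rewrite !inE.
have pos (I J : finType) (i : I) (j : J) : (#|I| * #|J|)%:R != 0 :> R.
  by rewrite pnatr_eq0 -lt0n muln_gt0; apply/andP; split; apply/card_gt0P; [exists i | exists j].
rewrite !mulrBl !divff ?(pos _ _ 0 1%g) ?(pos _ _ 1%g [ffun=> 1%g]) //.
rewrite -P_realE -P_idealE opprB [in X in X -> _]addrC addrA subrK; apply=> b.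
by rewrite ler0n lern1; case: b.
Qed.

End Cipher.

Theorem theorem1 (R : realFieldType) (n : nat) (w0 w1 w2 w3 : 'rV['F_2]_n -> 'rV['F_2]_n)
    (g : 'I_4 -> 'rV['F_2]_n -> 'rV['F_2]_n) (d1 d2 d3 : R) (qf qe : nat) :
  (1 <= n)%N ->
  good_ks w1 w2 g d1 d2 d3 ->
  (qf + 2 * qe <= 2 ^ n %/ 2)%N ->
  forall D : dist n, queries_ok D qf qe ->
  `|P_real R w0 w1 w2 w3 g D - P_ideal R D|
    <= 2 * d1 * qe%:R * qf%:R + (d2 + d3) * qe%:R ^+ 2
       + (8 * qe%:R * qf%:R + 27 * qe%:R ^+ 2 + 4 * qe%:R) / (2 ^ n)%:R.
Proof.
move=> n_gt0 ks sizes D okD.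
have cardV : #|{: 'rV['F_2]_n}| = (2 ^ n)%N by rewrite card_mx card_Fp // mul1n.
rewrite -cardV; apply: advantage_bound => //; rewrite cardV mulnC.
(* The floor in [2 ^ n %/ 2] only strengthens the hypothesis. *)
by apply: leq_trans (leq_trunc_div (2 ^ n) 2); rewrite leq_mul2r sizes orbT.
Qed.
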